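(* Let $p$ be a prime, $X=\Delta_p$, and let $\alpha=c=(c_0,c_1,\dots,c_n,\dots)\in\Delta_p^0$ be an arbitrary topological automorphism of $X$ (acting by multiplication). Then: 1. Let $\xi_1,\xi_2$ be independent random variables with values in $X$ and distributions $\mu_1,\mu_2$, and assume that the conditional distribution of $L_2=\xi_1+\alpha\xi_2$ given $L_1=\xi_1+\xi_2$ is symmetric. Then: (i) If $p>2$ and $c_0\neq p-1$, then $\mu_j=m_K*E_{x_j}$, $j=1,2$, where $K$ is a compact subgroup of $X$ and $x_j\in X$. Moreover, if $c_0=1$, then $\mu_1$ and $\mu_2$ are degenerate distributions. (ii) If $p=2$, $c_0=1$ and $c_1=0$, then $\mu_1$ and $\mu_2$ are degenerate distributions. 2. If either (i) $p>2$ and $c_0=p-1$, or (ii) $p=2$ and $c_0=c_1=1$, then there exist independent random variables $\xi_1,\xi_2$ with values in $X$ and distributions $\mu_1,\mu_2$ such that the conditional distribution of $L_2=\xi_1+\alpha\xi_2$ given $L_1=\xi_1+\xi_2$ is symmetric, whereas $\mu_1\notin I(X)$ and $\mu_2\notin I(X)$.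
   Context: $\Delta_p$ is the compact group of $p$-adic integers, elements written as digit sequences $x=(x_0,x_1,\dots)$, $x_n\in\{0,\dots,p-1\}$, with addition with carries; $\Delta_p^0=\{x\in\Delta_p:x_0\neq0\}$ is the set of invertible $p$-adic integers, and every topological automorphism of $\Delta_p$ is multiplication by an element of $\Delta_p^0$, with which we identify it. $m_K$ is the Haar probability measure of a compact subgroup $K$, $E_x$ the point mass at $x$, and $I(X)$ is the set of idempotent distributions on $X$, i.e. the shifts $m_K*E_x$ of Haar distributions of compact subgroups $K$. The conditional distribution of $L_2$ given $L_1$ is symmetric if it equals the conditional distribution of $-L_2$ given $L_1$. *)

(* Defs.v *)
From HB Require Import structures.
From mathcomp Require Import all_boot all_order all_algebra.
From mathcomp Require Import all_classical all_reals all_analysis.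

Set Implicit Arguments.
Unset Strict Implicit.
Unset Printing Implicit Defensive.
Import Order.TTheory GRing.Theory Num.Theory.

Local Open Scope classical_set_scope.

(* A p-adic digit.  For a prime p, [p.-1.+1 = p], so digits are 0..p-1.
   (The form p.-1.+1 only serves to make the type visibly inhabited.) *)
Definition digit (p : nat) := 'I_p.-1.+1.

(* Delta_p as the space of digit sequences x = (x_0, x_1, ...), with the
   product topology of the discrete digit spaces (the usual compact topology
   of the p-adic integers). *)
Definition DeltaT (p : nat) := nat -> digit p.
HB.instance Definition _ (p : nat) := Topological.copy (DeltaT p)
   (prod_topology (fun _ : nat => discrete_topology (digit p))).
HB.instance Definition _ (p : nat) := isPointed.Build (DeltaT p) (fun _ => ord0).

Definition Delta (p : nat) := g_sigma_algebraType (@open (DeltaT p)).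
HB.instance Definition _ (p : nat) :=
  Measurable.copy (Delta p) (g_sigma_algebraType (@open (DeltaT p))).

Definition trunc (p : nat) (n : nat) (x : nat -> digit p) : nat :=
  \sum_(k < n) (x k : nat) * p ^ k.

Definition dig (p n m : nat) : digit p := inord ((m %/ p ^ n) %% p).

(* addition with carries: the n-th digit of x + y only depends on x, y mod p^(n+1) *)
Definition padd (p : nat) (x y : Delta p) : Delta p :=
  fun n => @dig p n (@trunc p n.+1 x + @trunc p n.+1 y).

Definition pzero (p : nat) : Delta p := fun _ => ord0.

Definition popp (p : nat) (x : Delta p) : Delta p :=
  fun n => @dig p n (p ^ n.+1 - @trunc p n.+1 x).

Definition pmul (p : nat) (x y : Delta p) : Delta p :=
  fun n => @dig p n (@trunc p n.+1 x * @trunc p n.+1 y).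

Definition invertible (p : nat) (c : Delta p) : Prop := (c 0 : nat) != 0%N.

Definition compact_subgroup (p : nat) (K : set (Delta p)) : Prop :=
  compact (K : set (DeltaT p)) /\ K (pzero p) /\
  (forall x y, K x -> K y -> K (padd x (popp y))).

Section Measures.
Context (R : realType).
Local Open Scope ereal_scope.

Definition eq_distr (p : nat) (mu nu : set (Delta p) -> \bar R) : Prop :=
  forall A, measurable A -> mu A = nu A.

Definition padic_haar (p : nat) (K : set (Delta p)) (m : probability (Delta p) R) : Prop :=
  m K = 1 /\
  forall x, K x -> forall A, measurable A ->
    m ((fun y => padd x y) @^-1` A) = m A.

(* m * E_x : the pshift of m by x *)
Definition pshift (p : nat) (m : set (Delta p) -> \bar R) (x : Delta p) :
  set (Delta p) -> \bar R := fun A => m ((fun y => padd y x) @^-1` A).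

Definition in_I (p : nat) (mu : set (Delta p) -> \bar R) : Prop :=
  exists (K : set (Delta p)) (mK : probability (Delta p) R) (x : Delta p),
    compact_subgroup K /\ padic_haar K mK /\ eq_distr mu (pshift mK x).

Definition degenerate_distr (p : nat) (mu : set (Delta p) -> \bar R) : Prop :=
  exists x : Delta p, eq_distr mu (@dirac _ (Delta p) x R).

Definition distr_of d (Om : measurableType d) (P : probability Om R) (p : nat)
  (xi : Om -> Delta p) : set (Delta p) -> \bar R := pushforward P xi.

Definition indep_rv d (Om : measurableType d) (P : probability Om R) (p : nat)
  (xi1 xi2 : Om -> Delta p) : Prop :=
  forall A B, measurable A -> measurable B ->
    P (xi1 @^-1` A `&` xi2 @^-1` B) = P (xi1 @^-1` A) * P (xi2 @^-1` B).

Definition cond_dist d (Om : measurableType d) (P : probability Om R) (p : nat)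
  (L1 L2 : Om -> Delta p) (Q : R.-pker (Delta p) ~> (Delta p)) : Prop :=
  forall A B, measurable A -> measurable B ->
    P (L1 @^-1` A `&` L2 @^-1` B) = \int[pushforward P L1]_(x in A) Q x B.

Definition cond_symmetric d (Om : measurableType d) (P : probability Om R) (p : nat)
  (L1 L2 : Om -> Delta p) : Prop :=
  exists Q : R.-pker (Delta p) ~> (Delta p),
    cond_dist P L1 L2 Q /\ cond_dist P L1 (fun w => popp (L2 w)) Q.

End Measures.

(* Main.v *)
(* Everything is read off the finite quotients Z/p^n: a distribution on Delta_p
   is determined by its masses on the residue classes [cyl a].

   Part 1. Since (L1, L2) and (L1, -L2) have the same law, L1 + L2 ~ L1 - L2 and
   c L1 + L2 ~ c L1 - L2, that is
     2 xi1 + (1 + c) xi2 ~ (1 - c) xi2  and  (1 + c) xi1 + 2c xi2 ~ (c - 1) xi1.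
   If 2, c, 1 + c and 1 - c are units, the law of xi2 convolved with a multiple of
   xi1 is a rescaling of the law of xi2, hence has the same l2 norm; by strict
   convexity the law of xi2 is invariant under the differences of the support of
   xi1, and symmetrically.  So both laws are uniform on cosets of one subgroup.
   If instead 1 - c has larger valuation than 1 + c, comparing supports shows that
   they shrink to points.  In the limit K is the stabiliser of mu1, and mu1
   translated into K serves as its Haar measure.

   Part 2. Write c = -1 + 2f with p | f.  Take xi1, xi2 independent with a
   non-uniform first digit of full support and the remaining digits Haar
   distributed.  The linear involution
     (x, y) |-> (((1 - 2f) y - f x) / (1 - f), (x + f y) / (1 - f))
   swaps x and y modulo p, so it preserves the joint law, fixes L1 and negates L2. *)
Require Import Defs.
From HB Require Import structures.
From mathcomp Require Import all_boot all_order all_algebra.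
From mathcomp Require Import all_classical all_reals all_analysis measurable_realfun.
From mathcomp Require Import ring zify.

Set Implicit Arguments.
Unset Strict Implicit.
Unset Printing Implicit Defensive.
Import Order.TTheory GRing.Theory Num.Theory.
Local Open Scope classical_set_scope.
Local Open Scope ring_scope.

(** * Residues of [p]-adic integers modulo [p ^ n.+1] *)

(** The exponent is shifted by one because ['Z_m] is the ring of integers modulo [m] only for
    [m > 1]; level 0 sees exactly the first digit. *)
Definition phi {p : nat} (n : nat) (x : Delta p) : 'Z_(p ^ n.+1) :=
  (trunc n.+1 x)%:R.

Section Arithmetic.
Context {p : nat} (hp : prime p).
Implicit Types x y z : Delta p.

Lemma truncS n x : trunc n.+1 x = (trunc n x + x n * p ^ n)%N.
Proof. by rewrite /trunc big_ord_recr. Qed.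

Lemma digit_lt n x : (x n < p)%N.
Proof. by apply: leq_trans (ltn_ord (x n)) _; rewrite prednK // prime_gt0. Qed.

Lemma trunc_lt n x : (trunc n x < p ^ n)%N.
Proof.
elim: n => [|n IH]; first by rewrite /trunc big_ord0.
rewrite truncS expnS; apply: (@leq_trans (p ^ n + x n * p ^ n)).
  by rewrite ltn_add2r.
by rewrite -mulSn leq_mul2r digit_lt orbT.
Qed.

Lemma trunc_modS n x : (trunc n.+1 x = trunc n x %[mod p ^ n])%N.
Proof. by rewrite truncS addnC modnMDl. Qed.

Lemma modn_mulr_digit (a d q : nat) : (0 < d)%N -> (0 < q)%N ->
  (a %% (q * d) = a %% d + (a %/ d %% q) * d)%N.
Proof.
move=> d0 q0; rewrite {1}(divn_eq a d) {1}(divn_eq (a %/ d) q).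
rewrite mulnDl -mulnA -addnA modnMDl [X in (X %% _)%N]addnC modn_small //.
apply: (@leq_trans (((a %/ d) %% q).+1 * d)).
  by rewrite mulSn ltn_add2r ltn_mod.
by rewrite leq_mul2r ltn_mod q0 orbT.
Qed.

(** Sum, product and negative on [Delta p] all read their digits off naturals [m k] compatible
    modulo powers of [p]; this one computation turns each of them into a ring operation on
    residues. *)
Lemma trunc_dig (m : nat -> nat) n :
  (forall k, m k.+1 = m k %[mod p ^ k.+1])%N ->
  trunc n.+1 (fun k => dig p k (m k)) = (m n %% p ^ n.+1)%N.
Proof.
have p0 := prime_gt0 hp; move=> hm.
have E k a : (dig p k a : nat) = ((a %/ p ^ k) %% p)%N :> nat.
  by rewrite /dig inordK // prednK // ltn_mod.
elim: n => [|n IH]; first by rewrite /trunc big_ord1 E divn1 muln1 expn1.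
by rewrite truncS IH E (expnS _ n.+1) modn_mulr_digit ?expn_gt0 ?p0 // hm.
Qed.

Lemma expn_gt1 n : (1 < p ^ n.+1)%N.
Proof. by rewrite -{1}(exp1n n.+1) ltn_exp2r // prime_gt1. Qed.

Lemma natr_modZ n (a : nat) : (a %% p ^ n.+1)%:R = a%:R :> 'Z_(p ^ n.+1).
Proof. by apply: ord_inj; rewrite !val_Zp_nat ?expn_gt1 // modn_mod. Qed.

Lemma eq_natrZ n (a b : nat) :
  (a%:R = b%:R :> 'Z_(p ^ n.+1)) <-> (a = b %[mod p ^ n.+1])%N.
Proof.
split=> [h|]; first by have := congr1 (@nat_of_ord _) h; rewrite !val_Zp_nat ?expn_gt1.
by move=> h; rewrite -natr_modZ h natr_modZ.
Qed.

Lemma natr_eq0Z n (a : nat) : (a%:R == 0 :> 'Z_(p ^ n.+1)) = (p ^ n.+1 %| a)%N.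
Proof.
apply/eqP/eqP => [|h]; last by rewrite -natr_modZ h.
by move/(@eq_natrZ n a 0); rewrite mod0n.
Qed.

Lemma phi_eq n x y : phi n x = phi n y <-> trunc n.+1 x = trunc n.+1 y.
Proof.
rewrite /phi; split=> [/eq_natrZ|-> //].
by rewrite !modn_small ?trunc_lt.
Qed.

Lemma phi_dig (m : nat -> nat) n :
  (forall k, m k.+1 = m k %[mod p ^ k.+1])%N ->
  phi n (fun k => dig p k (m k)) = (m n)%:R.
Proof. by move=> hm; rewrite /phi trunc_dig // natr_modZ. Qed.

Lemma phiD n x y : phi n (padd x y) = phi n x + phi n y.
Proof.
rewrite (@phi_dig (fun k => trunc k.+1 x + trunc k.+1 y)%N) ?natrD // => k.
by rewrite -modnDm !trunc_modS modnDm.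
Qed.

Lemma phiM n x y : phi n (pmul x y) = phi n x * phi n y.
Proof.
rewrite (@phi_dig (fun k => trunc k.+1 x * trunc k.+1 y)%N) ?natrM // => k.
by rewrite -modnMm !trunc_modS modnMm.
Qed.

Lemma phiN n x : phi n (popp x) = - phi n x.
Proof.
have hle k : (trunc k x <= p ^ k)%N by apply/ltnW/trunc_lt.
rewrite (@phi_dig (fun k => p ^ k.+1 - trunc k.+1 x)%N) /=.
  rewrite natrB //; have -> : (p ^ n.+1)%:R = 0 :> 'Z_(p ^ n.+1).
    by apply/eqP; rewrite natr_eq0Z.
  by rewrite sub0r.
(* Subtraction of naturals is truncated, so compatibility is checked after adding [trunc k.+2 x] to
   both sides. *)
move=> k; apply/eqP; rewrite -(eqn_modDr (trunc k.+2 x)) subnK //.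
rewrite -modnDmr trunc_modS modnDmr subnK //.
by rewrite modnn expnS modnMl.
Qed.

Lemma phi0 n : phi n (pzero p) = 0.
Proof. by rewrite /phi /trunc big1. Qed.

Lemma phi_compat n k x y : (k <= n)%N -> phi n x = phi n y -> phi k x = phi k y.
Proof.
elim: n => [|n IH]; first by rewrite leqn0 => /eqP ->.
rewrite leq_eqVlt => /orP[/eqP -> //|hk] /phi_eq h; apply: IH => //.
apply/phi_eq; move: (congr1 (modn^~ (p ^ n.+1))%N h).
by rewrite /= !trunc_modS !modn_small ?trunc_lt.
Qed.

Lemma phi_ext n x y : phi n x = phi n y <-> (forall k, (k <= n)%N -> x k = y k).
Proof.
split=> [h k hk|h]; last first.
  by apply/phi_eq; apply: eq_bigr => -[k hk] _ /=; rewrite h.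
have hs i : (i <= n.+1)%N -> trunc i x = trunc i y.
  case: i => [|i hi]; first by rewrite /trunc !big_ord0.
  by apply/phi_eq; apply: phi_compat h.
apply: val_inj => /=.
have := hs k.+1 hk; rewrite !truncS hs 1?ltnW // => /addnI /eqP.
by rewrite eqn_mul2r expn_eq0 (gtn_eqF (prime_gt0 hp)) /= => /eqP.
Qed.

Definition ofnat (a : nat) : Delta p := fun k => dig p k a.

Lemma phi_ofnat n (a : nat) : phi n (ofnat a) = a%:R.
Proof. by rewrite (@phi_dig (fun=> a)). Qed.

Definition rep {n} (a : 'Z_(p ^ n.+1)) : Delta p := ofnat a.

Lemma repK n (a : 'Z_(p ^ n.+1)) : phi n (rep a) = a.
Proof. by rewrite phi_ofnat natr_Zp. Qed.

(** Reduction passes through a digit lift, so that for [k <= n] it inherits the homomorphism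
    properties of [phi]. *)
Definition red k {n} (a : 'Z_(p ^ n.+1)) : 'Z_(p ^ k.+1) := phi k (rep a).

Lemma red_phi k n x : (k <= n)%N -> red k (phi n x) = phi k x.
Proof. by move=> hk; apply: phi_compat hk _; rewrite repK. Qed.

Lemma redD k n (a b : 'Z_(p ^ n.+1)) : (k <= n)%N ->
  red k (a + b) = red k a + red k b.
Proof. by move=> hk; rewrite -{1}(repK a) -{1}(repK b) -phiD red_phi // phiD. Qed.

Lemma redM k n (a b : 'Z_(p ^ n.+1)) : (k <= n)%N ->
  red k (a * b) = red k a * red k b.
Proof. by move=> hk; rewrite -{1}(repK a) -{1}(repK b) -phiM red_phi // phiM. Qed.

Lemma redN k n (a : 'Z_(p ^ n.+1)) : (k <= n)%N -> red k (- a) = - red k a.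
Proof. by move=> hk; rewrite -{1}(repK a) -phiN red_phi // phiN. Qed.

Lemma red_nat k n (a : nat) : (k <= n)%N -> red k (a%:R : 'Z_(p ^ n.+1)) = a%:R.
Proof. by move=> hk; rewrite -phi_ofnat red_phi // phi_ofnat. Qed.

(** Units modulo a power of [p] are the residues prime to [p], and higher digits only add multiples
    of [p]. *)
Lemma phi_unit n x : (phi n x \is a GRing.unit) = (phi 0 x != 0).
Proof.
rewrite /phi !unitZpE ?expn_gt1 // coprime_pexpl //.
rewrite prime_coprime //; congr negb.
have -> : (p %| trunc n.+1 x)%N = (p %| trunc 1 x)%N.
  elim: n => // n <-; rewrite truncS dvdn_addl //.
  by rewrite expnS mulnCA dvdn_mulr.
by rewrite natr_eq0Z expn1.
Qed.

Lemma red_unit n (a : 'Z_(p ^ n.+1)) : (a \is a GRing.unit) = (red 0 a != 0).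
Proof. by rewrite -{1}(repK a) phi_unit. Qed.

Lemma phi0E x : phi 0 x = (x 0%N)%:R.
Proof. by rewrite /phi /trunc big_ord1 expn0 muln1. Qed.

End Arithmetic.

(** * Cylinders and measurability *)

Section Cylinders.
Context {p : nat} (hp : prime p).

Definition cyl n (a : 'Z_(p ^ n.+1)) : set (Delta p) := [set x | phi n x = a].

Lemma nbhs_cyl (x : DeltaT p) (A : set (DeltaT p)) : nbhs x A ->
  exists n, forall y, phi n y = phi n x -> A y.
Proof.
(* Convergence of this filter to [x] is tested digit by digit, and the [i]-th digit is constant on a
   cylinder of level [i]. *)
pose F : set_system (DeltaT p) :=
  [set B | exists n, forall y, phi n y = phi n x -> B y].
have FF : Filter F.
  split; first by exists 0%N.
  - move=> B C [n hn] [k hk]; exists (maxn n k) => y hy; split.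
      by apply: hn; apply: (phi_compat hp _ hy); rewrite leq_maxl.
    by apply: hk; apply: (phi_compat hp _ hy); rewrite leq_maxr.
  - by move=> B C BC [n hn]; exists n => y hy; apply/BC/hn.
suff cF : F --> x by move=> /cF.
apply/cvg_sup => i B [C [[V oV <-] /= Vx] CB]; exists i => y /(phi_ext hp) h.
by apply: CB => /=; rewrite h.
Qed.

Lemma open_cyl n (a : 'Z_(p ^ n.+1)) : open (cyl a : set (DeltaT p)).
Proof.
have -> : cyl a = \bigcap_(k in `I_n.+1)
    (proj k @^-1` [set rep a k] : set (DeltaT p)).
  apply/seteqP; split => x /=.
    by rewrite -{1}(repK hp a) => /(phi_ext hp) h k /= kn; apply: h.
  by move=> h; rewrite /cyl /= -[RHS](repK hp a); apply/(phi_ext hp) => k; exact: h.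
suff E (m : nat) :
    open (\bigcap_(k in `I_m) (proj k @^-1` [set rep a k] : set (DeltaT p))).
  exact: E.
elim: m => [|m IH]; first by rewrite II0 bigcap_set0; exact: openT.
rewrite IIS bigcap_setU; apply: openI => //; rewrite bigcap_set1.
apply: (@open_comp (DeltaT p) (discrete_topology (digit p)) (proj m)).
  by move=> y _; exact: (@proj_continuous _ (fun=> discrete_topology (digit p))).
exact: discrete_open.
Qed.

(** The threshold [n0] lets later arguments ignore finitely many low levels; the empty set and the
    whole space are added for closure under intersection and for covering. *)
Definition cyls n0 : set (set (Delta p)) :=
  [set A | A = set0 \/ A = setT \/ exists n (a : 'Z_(p ^ n.+1)), (n0 <= n)%N /\ A = cyl a].

Lemma cyls_setI n0 : setI_closed (cyls n0).
Proof.
have main n k (a : 'Z_(p ^ n.+1)) (b : 'Z_(p ^ k.+1)) :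
    (n0 <= n)%N -> (n <= k)%N -> cyls n0 (cyl a `&` cyl b).
  move=> hn hk; have [e|ne] := eqVneq (red n b) a; [right; right|left].
    exists k, b; split; first exact: leq_trans hk.
    apply/seteqP; split => x //=; first by case.
    by move=> xb; split=> //; rewrite /cyl /= -(red_phi hp _ hk) xb.
  rewrite -subset0 => x [/= xa xb]; move: ne.
  by rewrite -xb (red_phi hp _ hk) xa eqxx.
move=> A B [->|[->|[n [a [hn ->]]]]]; rewrite ?set0I ?setTI //; first by left.
move=> [->|[->|[k [b [hk ->]]]]]; rewrite ?setI0 ?setIT //; first by left.
  by right; right; exists n, a.
by have [h|/ltnW h] := leqP n k; [|rewrite setIC]; exact: main.
Qed.

Lemma measurable_cylsE n0 : @measurable _ (Delta p) = <<s cyls n0 >>.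
Proof.
apply/seteqP; split; last first.
  apply: smallest_sub; first exact: sigma_algebra_measurable.
  move=> A [->|[->|[n [a [_ ->]]]]]; [exact: measurable0|exact: measurableT|].
  by apply: sub_gen_smallest; exact: open_cyl.
apply: smallest_sub; first exact: smallest_sigma_algebra.
move=> U oU.
pose G : set (set (Delta p)) := cyls n0.
(* An open set is the countable union, over the levels from [n0] on, of the finitely many cylinders
   of that level inside it. *)
have -> : U = \bigcup_n (\bigcup_(a in [set a : 'Z_(p ^ (n0 + n).+1) | cyl a `<=` U])
    cyl a).
  apply/seteqP; split => [x Ux|x [n _ [a /= aU ax]]]; last exact: aU.
  have [|n hn] := @nbhs_cyl x U; first exact: open_nbhs_nbhs.
  exists n => //; exists (phi (n0 + n) x) => // y.
  by move=> /(phi_compat hp (leq_addl n0 n)); exact: hn.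
apply: (@bigcup_measurable _ (g_sigma_algebraType G)) => n _.
apply: (@fin_bigcup_measurable _ (g_sigma_algebraType G)) => //.
move=> a _; apply: sub_gen_smallest; right; right; exists (n0 + n)%N, a.
by rewrite leq_addr.
Qed.

Lemma measurable_cyl n (a : 'Z_(p ^ n.+1)) : measurable (cyl a).
Proof. by apply: sub_gen_smallest; exact: open_cyl. Qed.

Lemma measurable_fun_cyl d (T : measurableType d) (f : T -> Delta p) :
  (forall n a, measurable [set w | phi n (f w) = a]) -> measurable_fun setT f.
Proof.
move=> h; apply: (measurability (cyls 0)); first exact: (measurable_cylsE 0).
move=> _ [A [->|[->|[n [a [_ ->]]]]] <-]; rewrite ?setTI.
- by rewrite preimage_set0.
- by rewrite preimage_setT.
exact: h.
Qed.

End Cylinders.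

(** * Variables with finitely many values, and uniqueness of measures on cylinders *)

Section FiniteValued.
Context {d : measure_display} {T : measurableType d} {I : finType}.
Variables (X : T -> I) (mX : forall i, measurable [set w | X w = i]).

Lemma measurable_finval (Q : pred I) : measurable [set w | Q (X w)].
Proof.
have -> : [set w | Q (X w)] = \bigcup_(i in [set i | Q i]) [set w | X w = i].
  by apply/seteqP; split => w /= => [h|[i /= Qi ->] //]; exists (X w).
exact: fin_bigcup_measurable.
Qed.

Lemma measure_finval (R : realType) (mu : {measure set T -> \bar R}) (Q : pred I) :
  mu [set w | Q (X w)] = (\sum_(i | Q i) mu [set w | X w = i])%E.
Proof.
have main s : uniq s ->
    mu [set w | X w \in s] = (\sum_(i <- s) mu [set w | X w = i])%E.
  elim: s => [_|i s IH /= /andP[is_ us]].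
    by rewrite big_nil -(measure0 mu); congr (mu _); apply/seteqP; split.
  rewrite big_cons -IH // -measureU //.
  - congr (mu _); apply/seteqP; split => w /=; rewrite inE.
      by move=> /orP[/eqP|]; [left|right].
    by move=> [->|->]; rewrite ?eqxx ?orbT.
  - exact: (measurable_finval [in s]).
  by rewrite -subset0 => w [/= -> ]; rewrite (negbTE is_).
transitivity (mu [set w | X w \in enum Q]).
  by congr (mu _); apply/seteqP; split => w /=; rewrite mem_enum.
by rewrite main ?enum_uniq // big_enum.
Qed.

End FiniteValued.

Section CylinderExtension.
Context {p : nat} (hp : prime p).

(** Cylinders of level at least [n0] generate the Borel sets and are stable under intersection;
    total masses agree as sums over level [n0]. *)
Lemma measure_cyl_ext (R : realType) n0
    (m1 m2 : {measure set (Delta p) -> \bar R}) :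
  (m1 setT < +oo)%E ->
  (forall n (a : 'Z_(p ^ n.+1)), (n0 <= n)%N -> m1 (cyl a) = m2 (cyl a)) ->
  forall A, measurable A -> m1 A = m2 A.
Proof.
move=> fin ec.
have eT : m1 setT = m2 setT.
  have E (m : {measure set (Delta p) -> \bar R}) :
      m setT = (\sum_(a : 'Z_(p ^ n0.+1)) m (cyl a))%E.
    rewrite -(@measure_finval _ _ _ (phi n0) _ R m xpredT); first by congr (m _); apply/seteqP.
    by move=> a; exact: (measurable_cyl hp a).
  by rewrite !E; apply: eq_bigr => a _; exact: ec.
apply: (measure_unique (cyls n0) (fun=> setT)) => //.
- exact: measurable_cylsE.
- exact: cyls_setI.
- by move=> _; right; left.
- by apply: bigcup_const; exists 0%N.
by move=> A [->|[->|[n [a [hn ->]]]]]; rewrite ?measure0 //; exact: ec.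
Qed.

End CylinderExtension.

(** * Measurability of the [p]-adic operations, tested on residues *)

Section LevelMaps.
Context {p : nat} (hp : prime p).
Context {d : measure_display} {T : measurableType d}.
Implicit Types f g : T -> Delta p.

Lemma measurable_level n (Q : pred 'Z_(p ^ n.+1)) f :
  measurable_fun setT f -> measurable [set w | Q (phi n (f w))].
Proof.
move=> mf; apply: (@measurable_finval _ _ 'Z_(p ^ n.+1) (fun w => phi n (f w)) _ Q) => a.
by rewrite -[X in measurable X]setTI; exact: (mf measurableT _ (measurable_cyl hp a)).
Qed.

Lemma measurable_level2 n (Q : rel 'Z_(p ^ n.+1)) f g :
  measurable_fun setT f -> measurable_fun setT g ->
  measurable [set w | Q (phi n (f w)) (phi n (g w))].
Proof.
move=> mf mg.
apply: (@measurable_finval _ _ ('Z_(p ^ n.+1) * 'Z_(p ^ n.+1))%type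
  (fun w => (phi n (f w), phi n (g w))) _ (fun z => Q z.1 z.2)) => -[a b].
have -> : [set w | (phi n (f w), phi n (g w)) = (a, b)] =
    [set w | phi n (f w) == a] `&` [set w | phi n (g w) == b].
  apply/seteqP; split => w /=; first by case=> -> ->.
  by case=> /eqP -> /eqP ->.
by apply: measurableI; [exact: (measurable_level (pred1 a))|
  exact: (measurable_level (pred1 b))].
Qed.

Lemma measurable_padd f g : measurable_fun setT f -> measurable_fun setT g ->
  measurable_fun setT (fun w => padd (f w) (g w)).
Proof.
move=> mf mg; apply: (measurable_fun_cyl hp) => n a.
rewrite (_ : mkset _ = [set w | phi n (f w) + phi n (g w) == a]).
  exact: (measurable_level2 (fun u v => u + v == a)).
by apply/seteqP; split => w /=; rewrite phiD // => /eqP.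
Qed.

Lemma measurable_pmul c f : measurable_fun setT f ->
  measurable_fun setT (fun w => pmul c (f w)).
Proof.
move=> mf; apply: (measurable_fun_cyl hp) => n a.
rewrite (_ : mkset _ = [set w | phi n c * phi n (f w) == a]).
  exact: (measurable_level (fun u => phi n c * u == a)).
by apply/seteqP; split => w /=; rewrite phiM // => /eqP.
Qed.

Lemma measurable_popp f : measurable_fun setT f ->
  measurable_fun setT (fun w => popp (f w)).
Proof.
move=> mf; apply: (measurable_fun_cyl hp) => n a.
rewrite (_ : mkset _ = [set w | - phi n (f w) == a]).
  exact: (measurable_level (fun u => - u == a)).
by apply/seteqP; split => w /=; rewrite phiN // => /eqP.
Qed.

End LevelMaps.

(** * Laws on finite rings *)

Section FiniteLaws.
Context {R : realFieldType} {Z : finComUnitRingType}.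
Implicit Types (m : Z -> R) (c k e b t u : Z).

(* The law of [k X + e Y] is the law of [b Y], for independent [X], [Y] with
   laws [m1], [m2]. *)
Definition same_law m1 m2 k e b : Prop := forall t,
  \sum_(z : Z * Z | k * z.1 + e * z.2 == t) m1 z.1 * m2 z.2 =
  \sum_(y | b * y == t) m2 y.

(** Finite form of conditional symmetry: for independent [X], [Y] with these laws,
    [(X + Y, X + c Y)] and [(X + Y, - (X + c Y))] have the same joint law. *)
Definition sym_law m1 m2 c : Prop := forall a b,
  \sum_(z : Z * Z | (z.1 + z.2 == a) && (z.1 + c * z.2 == b)) m1 z.1 * m2 z.2 =
  \sum_(z : Z * Z | (z.1 + z.2 == a) && (z.1 + c * z.2 == - b)) m1 z.1 * m2 z.2.

(** The two equal joint laws are pushed forward along [(s, t) |-> u s + t]. *)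
Lemma sym_law_lin m1 m2 c u t : sym_law m1 m2 c ->
  \sum_(z : Z * Z | u * (z.1 + z.2) + (z.1 + c * z.2) == t) m1 z.1 * m2 z.2 =
  \sum_(z : Z * Z | u * (z.1 + z.2) - (z.1 + c * z.2) == t) m1 z.1 * m2 z.2.
Proof.
move=> hs.
rewrite (partition_big (fun z : Z * Z => (z.1 + z.2, z.1 + c * z.2))
  (fun w : Z * Z => u * w.1 + w.2 == t)) //=.
rewrite [RHS](partition_big (fun z : Z * Z => (z.1 + z.2, - (z.1 + c * z.2)))
  (fun w : Z * Z => u * w.1 + w.2 == t)) //=.
apply: eq_bigr => -[a b] /= hab.
transitivity (\sum_(z : Z * Z | (z.1 + z.2 == a) && (z.1 + c * z.2 == b)) m1 z.1 * m2 z.2).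
  apply: eq_bigl => z; rewrite xpair_eqE.
  by case: (z.1 + z.2 =P a) => [->|_]; case: (_ =P b) => [->|_]; rewrite ?hab ?andbF.
rewrite hs; apply: eq_bigl => z; rewrite xpair_eqE eqr_oppLR.
by case: (z.1 + z.2 =P a) => [->|_]; case: (_ =P - b) => [->|_];
  rewrite ?opprK ?hab ?andbF.
Qed.

Lemma sum_marginal2 m1 m2 (P : pred Z) : \sum_x m1 x = 1 ->
  \sum_(z : Z * Z | P z.2) m1 z.1 * m2 z.2 = \sum_(y | P y) m2 y.
Proof.
move=> s1.
rewrite -(pair_big_dep xpredT (fun _ y => P y) (fun x y => m1 x * m2 y)) /=.
under eq_bigr do rewrite -mulr_sumr.
by rewrite -mulr_suml s1 mul1r.
Qed.

Lemma sum_marginal1 m1 m2 (P : pred Z) : \sum_y m2 y = 1 ->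
  \sum_(z : Z * Z | P z.1) m1 z.1 * m2 z.2 = \sum_(x | P x) m1 x.
Proof.
move=> s2; rewrite -(sum_marginal2 m1 P s2).
rewrite (reindex_inj (h := fun z : Z * Z => (z.2, z.1))) /=; last first.
  by move=> [a b] [a' b'] [-> ->].
by apply: eq_bigr => z _; rewrite mulrC.
Qed.

Section Symmetric.
Context {m1 m2 : Z -> R} {c : Z}.
Variables (s1 : \sum_x m1 x = 1) (s2 : \sum_y m2 y = 1).
Variable hs : sym_law m1 m2 c.

(** Take [u = 1]: the variable of law [m1] cancels from the difference [L1 - L2]. *)
Lemma sym_same_law2 : same_law m1 m2 2 (1 + c) (1 - c).
Proof.
move=> t; rewrite -(sum_marginal2 m2 (fun y => (1 - c) * y == t) s1).
have := sym_law_lin 1 t hs.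
have E (F : Z * Z -> R) (P Q : pred (Z * Z)) : P =1 Q ->
  \sum_(z | P z) F z = \sum_(z | Q z) F z by move=> h; apply: eq_bigl.
rewrite (E _ _ (fun z => 2 * z.1 + (1 + c) * z.2 == t)) => [->|z]; last first.
  by congr (_ == _); ring.
by apply: eq_bigl => z; congr (_ == _); ring.
Qed.

(** Take [u = c]: now the variable of law [m2] cancels from [c L1 - L2]. *)
Lemma sym_same_law1 : same_law m2 m1 (2 * c) (1 + c) (c - 1).
Proof.
move=> t; rewrite -(sum_marginal1 m1 (fun x => (c - 1) * x == t) s2).
have := sym_law_lin c t hs.
have E (F : Z * Z -> R) (P Q : pred (Z * Z)) : P =1 Q ->
  \sum_(z | P z) F z = \sum_(z | Q z) F z by move=> h; apply: eq_bigl.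
rewrite (E _ _ (fun z => 2 * c * z.2 + (1 + c) * z.1 == t)) => [h|z]; last first.
  by congr (_ == _); ring.
rewrite (reindex_inj (h := fun z : Z * Z => (z.2, z.1))) /=; last first.
  by move=> [a b] [a' b'] [-> ->].
transitivity (\sum_(z : Z * Z | 2 * c * z.2 + (1 + c) * z.1 == t) m1 z.1 * m2 z.2).
  by apply: eq_bigr => z _; rewrite mulrC.
by rewrite h; apply: eq_bigl => z; congr (_ == _); ring.
Qed.

End Symmetric.

(* Translation by [k x] and rescaling preserve the l2 norm, so [m2] rescaled
   by [b] is an average of functions of its own norm; strict convexity forces
   all of them to coincide. *)
Lemma same_law_translate m1 m2 k e b x x' y :
  (forall x, 0 <= m1 x) -> \sum_x m1 x = 1 ->
  e \is a GRing.unit -> b \is a GRing.unit -> same_law m1 m2 k e b ->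
  0 < m1 x -> 0 < m1 x' -> m2 (y + k / e * (x - x')) = m2 y.
Proof.
move=> p1 s1 ue ub hl.
have uVe : e^-1 \is a GRing.unit by rewrite unitrV.
have uVb : b^-1 \is a GRing.unit by rewrite unitrV.
(* With [Y] of law [m2], [q] is the law of [b Y] and [r x] is the law of [k x + e Y]. *)
pose q t := m2 (t / b); pose r x t := m2 ((t - k * x) / e).
pose S := \sum_y m2 y ^+ 2.
have hq t : \sum_x m1 x * r x t = q t.
  transitivity (\sum_(z : Z * Z | k * z.1 + e * z.2 == t) m1 z.1 * m2 z.2).
    rewrite -(pair_big_dep xpredT (fun x y => k * x + e * y == t)
      (fun x y => m1 x * m2 y)) /=.
    apply: eq_bigr => z _; rewrite -mulr_sumr; congr (_ * _).
    rewrite (big_pred1 ((t - k * z) / e)) // => w /=.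
    apply/eqP/eqP => [<-|->]; first by rewrite [k * z + _]addrC addrK mulrC mulKr.
    by rewrite [e * _]mulrC divrK // addrC subrK.
  rewrite hl (big_pred1 (t / b)) // => w /=.
  by apply/eqP/eqP => [<-|->]; [rewrite mulrC mulKr|rewrite mulrC divrK].
have Sr z : \sum_t r z t ^+ 2 = S.
  rewrite /S [RHS](reindex_inj (h := fun t => (t - k * z) / e)) //.
  by move=> u v /(mulIr uVe) /addIr.
have Sq : \sum_t q t ^+ 2 = S.
  rewrite /S [RHS](reindex_inj (h := fun t => t / b)) //.
  by move=> u v /(mulIr uVb).
(* The mean squared distance from [r z] to its average [q] is [S + S - 2 S], since all these
   functions have squared norm [S]. *)
have V : \sum_z m1 z * (\sum_t (r z t - q t) ^+ 2) = 0.
  transitivity (\sum_z (m1 z * S + m1 z * S - (\sum_t m1 z * r z t * q t) *+ 2)).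
    apply: eq_bigr => z _.
    transitivity (m1 z * (\sum_t r z t ^+ 2 + \sum_t q t ^+ 2 -
        (\sum_t r z t * q t) *+ 2)).
      congr (_ * _); rewrite -sumrMnl -big_split -sumrB /=.
      by apply: eq_bigr => t _; ring.
    rewrite Sr Sq mulrBr mulrDr mulrnAr; congr (_ - _ *+ 2).
    by rewrite mulr_sumr; apply: eq_bigr => t _; rewrite mulrA.
  rewrite sumrB big_split /= -mulr_suml s1 mul1r sumrMnl exchange_big /=.
  rewrite (eq_bigr (fun t => q t ^+ 2)) ?Sq; first by ring.
  by move=> t _; rewrite -mulr_suml hq.
have Z0 z t : 0 < m1 z -> r z t = q t.
  move=> hz; have := V; move/eqP; rewrite psumr_eq0 => [/allP/(_ z)|]; last first.
    by move=> w _; apply: mulr_ge0 => //; apply: sumr_ge0 => *; exact: sqr_ge0.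
  rewrite mem_index_enum mulf_eq0 (gt_eqF hz) /= => /(_ isT).
  rewrite psumr_eq0 => [/allP/(_ t)|w _]; last exact: sqr_ge0.
  by rewrite mem_index_enum sqrf_eq0 subr_eq0 => /(_ isT) /eqP.
move=> hx hx'.
(* The argument is chosen so that [r x] returns [m2 y] and [r x'] returns the translated value. *)
have := Z0 x' (e * y + k * x) hx'; rewrite -(Z0 x) // /r.
rewrite (_ : (e * y + k * x - k * x) / e = y); last by rewrite addrK mulrC mulKr.
move=> <-; congr m2; apply: (mulIr ue); rewrite divrK // mulrDl.
by rewrite [k / e * _ * e]mulrAC divrK //; ring.
Qed.

Lemma same_law_supp m1 m2 k e b x y :
  (forall x, 0 <= m1 x) -> (forall y, 0 <= m2 y) -> same_law m1 m2 k e b ->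
  0 < m1 x -> 0 < m2 y -> exists2 w, 0 < m2 w & b * w = k * x + e * y.
Proof.
move=> p1 p2 hl hx hy.
have : 0 < \sum_(w | b * w == k * x + e * y) m2 w.
  rewrite -hl (bigD1 (x, y)) //=; apply: ltr_pwDl; first exact: mulr_gt0.
  by apply: sumr_ge0 => z _; exact: mulr_ge0.
rewrite lt_neqAle eq_sym => /andP[/eqP h _].
have /existsP[w /andP[/eqP wE hw]] : [exists w, (b * w == k * x + e * y) && (0 < m2 w)].
  apply: contra_notT h; rewrite negb_exists => /forallP h; apply: big1 => w hw.
  by have := h w; rewrite hw /= lt_neqAle p2 andbT negbK => /eqP.
by exists w.
Qed.

(** [b] carries one more factor [pi] than [e]. Matching supports replaces [y], [y'] by support
    points [w], [w'] with [e (y - y') = b (w - w')], which gains a factor [pi] each time, and [pi]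
    is nilpotent. *)
Lemma same_law_collapse m1 m2 k e b (tau eps del pi : Z) N x1 y y' :
  (forall x, 0 <= m1 x) -> (forall y, 0 <= m2 y) -> same_law m1 m2 k e b ->
  e = tau * eps -> b = tau * pi * del -> eps \is a GRing.unit -> pi ^+ N = 0 ->
  0 < m1 x1 -> 0 < m2 y -> 0 < m2 y' -> tau * y = tau * y'.
Proof.
move=> p1 p2 hl he hb ue hN hx1.
(* The induction lowers the surviving power of [pi] from [N], where it is zero, down to [0]. *)
suff main j : forall y y', 0 < m2 y -> 0 < m2 y' ->
    pi ^+ (N - j) * tau * (y - y') = 0.
  move=> hy hy'; have := main N y y' hy hy'; rewrite subnn expr0 mul1r mulrBr.
  by move/eqP; rewrite subr_eq0 => /eqP.
elim: j => [|j IH] {}y {}y' hy hy'; first by rewrite subn0 hN !mul0r.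
have [w hw wE] := same_law_supp p1 p2 hl hx1 hy.
have [w' hw' wE'] := same_law_supp p1 p2 hl hx1 hy'.
(* Once [j] reaches [N], truncated subtraction makes both exponents zero and nothing changes. *)
have [hj|hj] := leqP N j.
  by have := IH y y' hy hy'; rewrite (_ : N - j = N - j.+1)%N //; lia.
apply: (mulIr ue); rewrite mul0r.
have -> : pi ^+ (N - j.+1) * tau * (y - y') * eps =
  pi ^+ (N - j.+1) * (b * w - b * w') by rewrite wE wE' he; ring.
rewrite hb -[RHS](mulr0 del) -(IH w w') // (_ : N - j = (N - j.+1).+1)%N; last lia.
by rewrite exprS; ring.
Qed.

End FiniteLaws.

(** * Laws on cyclic rings: invariance and cosets *)

Section CyclicLaws.
Context {R : realFieldType} {n : nat}.
Local Notation Z := 'Z_n.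
Implicit Types m : Z -> R.

(** Every scalar of a cyclic ring is a natural number, so multiplying by it is repeated addition. *)
Lemma invariant_scale m (h r : Z) :
  (forall y, m (y + h) = m y) -> forall y, m (y + r * h) = m y.
Proof.
move=> hm y; rewrite -(natr_Zp r) mulr_natl.
elim: (nat_of_ord r) => [|k IH]; first by rewrite mulr0n addr0.
by rewrite mulrSr addrA hm.
Qed.

(** Each law is invariant under differences of support points of the other. The two laws then have
    the same invariances, each is uniform on a coset, and comparing total masses matches the
    constants. *)
Lemma sym_law_coset m1 m2 (c x0 y0 : Z) :
  (forall x, 0 <= m1 x) -> (forall y, 0 <= m2 y) ->
  \sum_x m1 x = 1 -> \sum_y m2 y = 1 -> sym_law m1 m2 c ->
  2 \is a @GRing.unit Z -> c \is a GRing.unit ->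
  1 + c \is a GRing.unit -> 1 - c \is a GRing.unit ->
  0 < m1 x0 -> 0 < m2 y0 ->
  (forall x, 0 < m1 x -> forall y, m1 (y + (x - x0)) = m1 y) /\
  (forall a, m2 a = m1 (a - y0 + x0)).
Proof.
move=> p1 p2 s1 s2 hs u2 uc uc1 uc1' hx0 hy0.
have scale m (u h : Z) : u \is a GRing.unit ->
    (forall y, m (y + u * h) = m y) -> forall y, m (y + h) = m y.
  by move=> uu /(@invariant_scale m _ u^-1) H y; rewrite -(mulKr uu h).
have A x x' : 0 < m1 x -> 0 < m1 x' -> forall y, m2 (y + (x - x')) = m2 y.
  move=> hx hx'; apply: (@scale m2 (2 / (1 + c))); first by rewrite unitrM u2 unitrV.
  by move=> y; apply: (same_law_translate y p1 s1 uc1 uc1' (sym_same_law2 s1 hs)).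
have B y y' : 0 < m2 y -> 0 < m2 y' -> forall x, m1 (x + (y - y')) = m1 x.
  move=> hy hy'; apply: (@scale m1 (2 * c / (1 + c))).
    by rewrite !unitrM u2 uc unitrV.
  move=> x; apply: (same_law_translate x p2 s2 uc1 _ (sym_same_law1 s2 hs)) => //.
  by rewrite -opprB unitrN.
(* An invariance [h] of [m1] keeps [x0 + h] in the support, so [h] is a difference to which [A]
   applies. *)
have I12 h : (forall x, m1 (x + h) = m1 x) -> forall y, m2 (y + h) = m2 y.
  by move=> hh; have := A (x0 + h) x0; rewrite hh addrAC subrr add0r; apply.
have I21 h : (forall x, m2 (x + h) = m2 x) -> forall y, m1 (y + h) = m1 y.
  by move=> hh; have := B (y0 + h) y0; rewrite hh addrAC subrr add0r; apply.
have hA x : 0 < m1 x -> forall y, m1 (y + (x - x0)) = m1 y.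
  by move=> hx; apply: I21; exact: A.
split=> //.
have hE a : m2 a * m1 x0 = m1 (a - y0 + x0) * m2 y0.
  have [h|h] := boolP (0 < m2 a).
    have E := B _ _ h hy0; have := I12 _ E y0; rewrite addrC subrK => ->.
    by rewrite [a - y0 + x0]addrC E mulrC.
  have [h'|h'] := boolP (0 < m1 (a - y0 + x0)).
    have := I12 _ (hA _ h') y0; rewrite addrK addrC subrK => e.
    by rewrite e hy0 in h.
  have z (x : R) : 0 <= x -> ~~ (0 < x) -> x = 0.
    by rewrite le_eqVlt => /orP[/eqP <-|->].
  by rewrite (z _ (p2 _) h) (z _ (p1 _) h') !mul0r.
(* Summing [hE] over all [a] leaves only the two constants, both laws having mass 1. *)
have e : m1 x0 = m2 y0.
  rewrite -[LHS]mul1r -s2 mulr_suml (eq_bigr _ (fun a _ => hE a)) -mulr_suml.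
  rewrite (_ : \sum_i _ = 1) ?mul1r // -s1 [RHS](reindex_inj (h := fun a => a - y0 + x0)) //.
  by move=> u v /addIr /addIr.
move=> a; have := hE a; rewrite e => /mulIf; apply; exact: lt0r_neq0.
Qed.

End CyclicLaws.

Lemma pushforward_probability {R : realType} d d' (T : measurableType d)
    (U : measurableType d') (P : probability T R) (f : T -> U) : measurable_fun setT f ->
  exists mu : probability U R, forall A, mu A = P (f @^-1` A).
Proof.
move=> mf; pose X : {mfun T >-> U} := HB.pack f (isMeasurableFun.Build _ _ _ _ _ mf).
by exists (distribution P X).
Qed.

(** * Distributions on the p-adic integers *)

Section Law.
Context {R : realType} {p : nat} (hp : prime p).
Implicit Types mu : probability (Delta p) R.

Definition law mu n (a : 'Z_(p ^ n.+1)) : R := fine (mu (cyl a)).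

Lemma lawE mu n (a : 'Z_(p ^ n.+1)) : mu (cyl a) = (law mu a)%:E.
Proof.
by rewrite /law fineK // fin_num_measure //; exact: measurable_cyl.
Qed.

Lemma law_ge0 mu n (a : 'Z_(p ^ n.+1)) : 0 <= law mu a.
Proof. by rewrite -lee_fin -lawE. Qed.

Lemma law_pred mu n (Q : pred 'Z_(p ^ n.+1)) :
  mu [set x | Q (phi n x)] = (\sum_(a | Q a) law mu a)%:E.
Proof.
rewrite (@measure_finval _ _ _ (phi n)) => [|a]; last exact: measurable_cyl.
by rewrite -sumEFin; apply: eq_bigr => a _; exact: lawE.
Qed.

Lemma law_sum1 mu n : \sum_(a : 'Z_(p ^ n.+1)) law mu a = 1.
Proof.
apply/EFin_inj; rewrite -(law_pred mu xpredT) -(probability_setT mu).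
by congr (mu _); apply/seteqP; split.
Qed.

Lemma law_ext mu nu n0 :
  (forall n (a : 'Z_(p ^ n.+1)), (n0 <= n)%N -> law mu a = law nu a) ->
  forall A, measurable A -> mu A = nu A.
Proof.
move=> h; apply: (@measure_cyl_ext _ hp _ n0).
- by apply: (@le_lt_trans _ _ 1%E);
    [rewrite le_eqVlt (introT eqP (probability_setT mu))|rewrite ltry].
move=> n a hn; apply: (etrans (lawE mu a)); apply: etrans (esym (lawE nu a)).
by rewrite h.
Qed.

(** The complement is a countable union, over the levels, of null sets. *)
Lemma prob1_all_levels mu (Q : forall n, pred 'Z_(p ^ n.+1)) :
  (forall n a, 0 < law mu a -> Q n a) ->
  mu [set x | forall n, Q n (phi n x)] = 1%E.
Proof.
move=> hQ.
have mQ n : measurable [set x : Delta p | ~~ Q n (phi n x)].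
  apply: (@measurable_finval _ _ _ (phi n) _ (fun a => ~~ Q n a)) => a.
  exact: measurable_cyl.
have -> : [set x | forall n, Q n (phi n x)] =
    ~` \bigcup_n [set x : Delta p | ~~ Q n (phi n x)].
  apply/seteqP; split => x /=; first by move=> h [n _ /= /negP]; apply.
  by move=> h n; apply: contra_notT h => h; exists n.
rewrite probability_setC; last exact: bigcupT_measurable.
have : mu.-negligible (\bigcup_n [set x : Delta p | ~~ Q n (phi n x)]).
  apply: negligible_bigcup => n; exists [set x : Delta p | ~~ Q n (phi n x)]; split=> //.
  apply: (etrans (law_pred mu (fun a => ~~ Q n a))).
  rewrite big1 // => a; apply: contraNeq => h.
  by apply: hQ; rewrite lt0r h law_ge0.
by move/measure_negligible => -> //; [rewrite sube0|exact: bigcupT_measurable].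
Qed.

(** Points all of whose cylinders have positive mass form a set of mass 1, hence a nonempty one. *)
Lemma law_supp mu : exists x, forall n, 0 < law mu (phi n x).
Proof.
have h : mu [set x | forall n, 0 < law mu (phi n x)] = 1%E.
  exact: (@prob1_all_levels mu (fun n a => 0 < law mu a)).
apply: contrapT => hN; move: h.
rewrite (_ : [set _ | _] = set0) ?measure0; first by move/eqP; rewrite lt_eqF.
by apply/seteqP; split => // x hx; apply: hN; exists x.
Qed.

Lemma law_pushforward (nu mu : probability (Delta p) R) (g : Delta p -> Delta p) n
    (Q : pred 'Z_(p ^ n.+1)) (a : 'Z_(p ^ n.+1)) :
  (forall A, nu A = mu (g @^-1` A)) ->
  (forall x, (phi n (g x) == a) = Q (phi n x)) ->
  law nu a = \sum_(b | Q b) law mu b.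
Proof.
move=> hnu hQ; apply/EFin_inj; rewrite -lawE hnu -law_pred; congr (mu _).
apply/seteqP; split => x; rewrite /= -hQ /cyl /=; first by move=> ->.
by move/eqP.
Qed.

Lemma law_red mu n k (a : 'Z_(p ^ n.+1)) : (n <= k)%N ->
  law mu a = \sum_(b : 'Z_(p ^ k.+1) | red n b == a) law mu b.
Proof.
move=> hk; apply/EFin_inj; rewrite -law_pred -lawE; congr (mu _).
apply/seteqP; split => x; rewrite /= red_phi // /cyl /=; first by move=> ->.
by move/eqP.
Qed.

Lemma law_lift mu n k (a : 'Z_(p ^ n.+1)) : (n <= k)%N -> 0 < law mu a ->
  exists2 b : 'Z_(p ^ k.+1), red n b = a & 0 < law mu b.
Proof.
move=> hk; rewrite (law_red mu _ hk) => h.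
have /existsP[b /andP[/eqP hb b0]] :
    [exists b : 'Z_(p ^ k.+1), (red n b == a) && (0 < law mu b)].
  apply: contraLR h; rewrite negb_exists -leNgt => /forallP h.
  rewrite big1 // => b hb; have := h b; rewrite hb /= lt0r law_ge0 andbT negbK.
  by move/eqP.
by exists b.
Qed.

Lemma law_degenerate mu x : (forall n (a : 'Z_(p ^ n.+1)), 0 < law mu a -> a = phi n x) ->
  forall A, measurable A -> mu A = @dirac _ (Delta p) x R A.
Proof.
move=> h.
have h0 n (a : 'Z_(p ^ n.+1)) : a != phi n x -> law mu a = 0.
  by apply: contraNeq => ha; apply/eqP/h; rewrite lt0r ha law_ge0.
apply: (@measure_cyl_ext _ hp _ 0).
- by apply: (@le_lt_trans _ _ 1%E);
    [rewrite le_eqVlt (introT eqP (probability_setT mu))|rewrite ltry].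
move=> n a _; apply: (etrans (lawE mu a)); rewrite /= diracE.
have [->|ne] := eqVneq a (phi n x).
  rewrite mem_set // -(law_sum1 mu n) (bigD1 (phi n x)) //= big1 ?addr0 // => b.
  exact: h0.
by rewrite h0 // memNset // /cyl /= => e; rewrite e eqxx in ne.
Qed.

End Law.

(** * Joint residues of two independent variables *)

Section Joint.
Context {R : realType} {p : nat} (hp : prime p).
Context {d : measure_display} {Om : measurableType d} {P : probability Om R}.
Context {xi1 xi2 : Om -> Delta p} {mu1 mu2 : probability (Delta p) R}.
Hypothesis m1 : measurable_fun setT xi1.
Hypothesis m2 : measurable_fun setT xi2.
Hypothesis law1 : forall A, measurable A -> mu1 A = P (xi1 @^-1` A).
Hypothesis law2 : forall A, measurable A -> mu2 A = P (xi2 @^-1` A).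
Hypothesis ind : indep_rv P xi1 xi2.

Lemma joint_law n (Q : rel 'Z_(p ^ n.+1)) :
  P [set w | Q (phi n (xi1 w)) (phi n (xi2 w))] =
  (\sum_(z : 'Z_(p ^ n.+1) * 'Z_(p ^ n.+1) | Q z.1 z.2)
     law mu1 z.1 * law mu2 z.2)%:E.
Proof.
have E (a b : 'Z_(p ^ n.+1)) : [set w | (phi n (xi1 w), phi n (xi2 w)) = (a, b)] =
    xi1 @^-1` cyl a `&` xi2 @^-1` cyl b.
  by apply/seteqP; split => w; rewrite /cyl /=; [case=> -> ->|case=> -> ->].
rewrite (@measure_finval _ _ ('Z_(p ^ n.+1) * 'Z_(p ^ n.+1))%type
  (fun w => (phi n (xi1 w), phi n (xi2 w))) _ _ P (fun z => Q z.1 z.2)); last first.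
  move=> [a b]; rewrite E; apply: measurableI; rewrite -[X in measurable X]setTI.
    by apply: m1 => //; exact: measurable_cyl.
  by apply: m2 => //; exact: measurable_cyl.
rewrite -sumEFin; apply: eq_bigr => -[a b] _ /=; rewrite E.
apply: etrans (ind (measurable_cyl hp a) (measurable_cyl hp b)) _.
by rewrite -law1 -?law2 ?lawE //; exact: measurable_cyl.
Qed.

Lemma joint_cyl2 c n (a b : 'Z_(p ^ n.+1)) :
  P ((fun w => padd (xi1 w) (xi2 w)) @^-1` cyl a `&`
     (fun w => padd (xi1 w) (pmul c (xi2 w))) @^-1` cyl b) =
  (\sum_(z : 'Z_(p ^ n.+1) * 'Z_(p ^ n.+1) |
      (z.1 + z.2 == a) && (z.1 + phi n c * z.2 == b))
     law mu1 z.1 * law mu2 z.2)%:E.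
Proof.
rewrite -(joint_law (fun x y => (x + y == a) && (x + phi n c * y == b))).
congr (P _); apply/seteqP; split => w; rewrite /cyl /= !phiD // phiM //.
  by case=> -> ->; rewrite !eqxx.
by move=> /andP[/eqP -> /eqP ->].
Qed.

Lemma cyl_popp n (b : 'Z_(p ^ n.+1)) (f : Om -> Delta p) :
  (fun w => popp (f w)) @^-1` cyl b = f @^-1` cyl (- b).
Proof.
apply/seteqP; split => w; rewrite /cyl /= phiN //; first by move=> <-; rewrite opprK.
by move=> ->; rewrite opprK.
Qed.

(** One kernel [Q] integrates to the joint probabilities of both pairs, which are then compared on
    cylinders. *)
Lemma cond_symmetric_law c n :
  cond_symmetric P (fun w => padd (xi1 w) (xi2 w))
                   (fun w => padd (xi1 w) (pmul c (xi2 w))) ->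
  sym_law (@law R p mu1 n) (@law R p mu2 n) (phi n c).
Proof.
move=> [Q [h1 h2]] a b; apply/EFin_inj; rewrite -!joint_cyl2 -cyl_popp.
by rewrite h1 ?h2 //; exact: measurable_cyl.
Qed.

End Joint.

(** * The stabiliser of [mu1] and its Haar measure *)

Section Coset.
Context {R : realType} {p : nat} (hp : prime p).
Context {mu1 mu2 : probability (Delta p) R} {x1 x2 : Delta p}.
Hypothesis coset1 : forall n (x : 'Z_(p ^ n.+1)), 0 < law mu1 x ->
  forall y, law mu1 (y + (x - phi n x1)) = law mu1 y.
Hypothesis coset2 : forall n (a : 'Z_(p ^ n.+1)),
  law mu2 a = law mu1 (a - phi n x2 + phi n x1).

Definition stabiliser : set (Delta p) :=
  [set h | forall n, [forall a, law mu1 (a + phi n h) == law mu1 a]].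

Lemma compact_stabiliser : compact_subgroup stabiliser.
Proof.
split; [|split].
- apply: (@subclosed_compact (DeltaT p) _ setT) => //.
    (* The stabiliser is closed: a limit point shares its level [n] residue with a member, and the
       level [n] condition sees only that residue. *)
    move=> x hx n; have [|y [hy e]] := hx (cyl (phi n x)).
      apply: open_nbhs_nbhs; split=> //; exact: open_cyl.
    by rewrite -(e : phi n y = phi n x); exact: hy.
  have := @tychonoff nat (fun=> discrete_topology (digit p)) (fun=> setT).
  rewrite (_ : [set _ | _] = setT); last by apply/seteqP; split.
  by apply => _; apply: finite_compact; exact: (@finite_finset (digit p)).
- by move=> n; apply/forallP => a; rewrite phi0 addr0.
- move=> x y hx hy n; apply/forallP => a; rewrite phiD // phiN //.
  rewrite addrA addrAC (eqP (forallP (hx n) _)).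
  by rewrite -(eqP (forallP (hy n) (a - phi n y))) subrK.
Qed.

(** [mK] is [mu1] translated by [- x1]. By [coset1] every residue it charges stabilises [mu1], so it
    lives on the stabiliser, which leaves it invariant. *)
Lemma haar_of_cosets :
  exists (K : set (Delta p)) (mK : probability (Delta p) R) (x1 x2 : Delta p),
    compact_subgroup K /\ padic_haar K mK /\
    eq_distr mu1 (pshift mK x1) /\ eq_distr mu2 (pshift mK x2).
Proof.
have mid : measurable_fun setT (id : Delta p -> Delta p) by exact: measurable_id.
have mshift (x : Delta p) : measurable_fun setT (fun y : Delta p => padd y x).
  exact: measurable_padd.
have [mK mKE] := pushforward_probability mu1 (mshift (popp x1)).
have lawK n (a : 'Z_(p ^ n.+1)) : law mK a = law mu1 (a + phi n x1).
  rewrite (law_pushforward hp (Q := pred1 (a + phi n x1)) mKE) ?big_pred1_eq // => y.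
  by rewrite phiD // phiN // subr_eq.
exists stabiliser, mK, x1, x2; split; first exact: compact_stabiliser.
split; [split|split].
- have hQ n (a : 'Z_(p ^ n.+1)) : 0 < law mK a ->
      [forall b, law mu1 (b + a) == law mu1 b].
    rewrite lawK => /coset1 h; apply/forallP => b; apply/eqP.
    by have := h b; rewrite addrK.
  exact: (prob1_all_levels hp hQ).
- move=> x hx.
  have mx : measurable_fun setT (fun y : Delta p => padd x y).
    exact: measurable_padd.
  have [nu nuE] := pushforward_probability mK mx.
  move=> A mA; rewrite -nuE; apply: (law_ext hp (n0 := 0)) mA => n a _.
  rewrite (law_pushforward hp (Q := pred1 (a - phi n x)) nuE) ?big_pred1_eq => [|y].
    rewrite !lawK; have /forallP/(_ (a - phi n x + phi n x1))/eqP <- := hx n.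
    by rewrite addrAC subrK.
  by rewrite phiD // /= [RHS]eq_sym subr_eq eq_sym addrC.
- have [nu nuE] := pushforward_probability mK (mshift x1).
  move=> A mA; rewrite /pshift -nuE; apply: (law_ext hp (n0 := 0)) mA => n a _.
  rewrite (law_pushforward hp (Q := pred1 (a - phi n x1)) nuE) ?big_pred1_eq => [|y].
    by rewrite lawK subrK.
  by rewrite phiD // /= [RHS]eq_sym subr_eq eq_sym.
- have [nu nuE] := pushforward_probability mK (mshift x2).
  move=> A mA; rewrite /pshift -nuE; apply: (law_ext hp (n0 := 0)) mA => n a _.
  rewrite (law_pushforward hp (Q := pred1 (a - phi n x2)) nuE) ?big_pred1_eq => [|y].
    by rewrite lawK coset2.
  by rewrite phiD // /= [RHS]eq_sym subr_eq eq_sym.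
Qed.

End Coset.

(** * From finite levels to rigidity on [Delta p] *)

Section Rigidity.
Context {R : realType} {p : nat} (hp : prime p).
Context {mu1 mu2 : probability (Delta p) R} {c : Delta p}.
Hypothesis hs : forall n, sym_law (@law R p mu1 n) (@law R p mu2 n) (phi n c).

(** Units are recognised by their first digit, so the conditions modulo [p] make [2], [c], [1 + c]
    and [1 - c] units at every level at once. *)
Lemma rigid_units : (2 < p)%N -> phi 0 c != 0 -> phi 0 c != 1 -> phi 0 c != -1 ->
  exists (K : set (Delta p)) (mK : probability (Delta p) R) (x1 x2 : Delta p),
    compact_subgroup K /\ padic_haar K mK /\
    eq_distr mu1 (pshift mK x1) /\ eq_distr mu2 (pshift mK x2).
Proof.
move=> p2 c0 c1 cN1.
have [x1 h1] := law_supp hp mu1; have [x2 h2] := law_supp hp mu2.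
have main n := sym_law_coset (law_ge0 hp mu1 (n := n)) (law_ge0 hp mu2 (n := n))
  (law_sum1 hp mu1 n) (law_sum1 hp mu2 n) (@hs n) _ _ _ _ (h1 n) (h2 n).
have u2 n : (2 : 'Z_(p ^ n.+1)) \is a GRing.unit.
  rewrite red_unit // red_nat // natr_eq0Z // expn1.
  by apply: contraTN p2 => /dvdn_leq; rewrite -leqNgt; apply.
have uc n : phi n c \is a GRing.unit by rewrite phi_unit.
have up n : 1 + phi n c \is a GRing.unit.
  rewrite red_unit // redD // (red_nat hp 1) // red_phi // addrC.
  by rewrite -[1%:R]opprK subr_eq0.
have um n : 1 - phi n c \is a GRing.unit.
  by rewrite red_unit // redD // redN // (red_nat hp 1) // red_phi // subr_eq0 eq_sym.
apply: (@haar_of_cosets _ _ hp mu1 mu2 x1 x2).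
  by move=> n; have [] := main u2 uc up um n.
by move=> n; have [] := main u2 uc up um n.
Qed.

(** [tau] is the exact power of [p] in [1 + c], and [1 - c] has at least one factor [p] more; it
    will be [1] for odd [p] and [2] for [p = 2]. *)
Lemma rigid_degenerate (tau : nat) :
  (forall n (b b' : 'Z_(p ^ n.+2)), tau%:R * b = tau%:R * b' -> red n b = red n b') ->
  (forall n, exists eps del : 'Z_(p ^ n.+2),
     [/\ 1 + phi n.+1 c = tau%:R * eps, 1 - phi n.+1 c = tau%:R * p%:R * del
       & eps \is a GRing.unit]) ->
  degenerate_distr mu1 /\ degenerate_distr mu2.
Proof.
move=> htau hc.
have [x1 h1] := law_supp hp mu1; have [x2 h2] := law_supp hp mu2.
have pN n : p%:R ^+ n.+2 = 0 :> 'Z_(p ^ n.+2).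
  by apply/eqP; rewrite -natrX natr_eq0Z.
(* A charged residue is lifted one level up and compared there with the support point; cancelling
   [tau] costs at most the extra digit. *)
split; [exists x1|exists x2]; apply: law_degenerate => // n a ha;
  have [b <- hb] := law_lift hp (leqnSn n) ha; rewrite -(red_phi hp _ (leqnSn n));
  apply: htau; have [eps [del [e1 e2 ue]]] := hc n.
  apply: (same_law_collapse (law_ge0 hp mu2 (n := n.+1)) (law_ge0 hp mu1 (n := n.+1))
    (sym_same_law1 (law_sum1 hp mu2 n.+1) (@hs n.+1)) e1 _ ue (pN n) (h2 n.+1) hb (h1 n.+1)).
  by rewrite -opprB e2 -mulrN.
exact: (same_law_collapse (law_ge0 hp mu1 (n := n.+1)) (law_ge0 hp mu2 (n := n.+1))
    (sym_same_law2 (law_sum1 hp mu1 n.+1) (@hs n.+1)) e1 e2 ue (pN n) (h1 n.+1) hb (h2 n.+1)).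
Qed.

End Rigidity.

(** * Degenerate cases of the first part *)

Section PartOne.
Context {R : realType} {p : nat} (hp : prime p).

Lemma red_eq0 n k (a : 'Z_(p ^ n.+1)) : red k a = 0 ->
  exists q, a = (p ^ k.+1)%:R * q.
Proof.
rewrite /red phi_ofnat // => /eqP; rewrite natr_eq0Z // => /dvdnP[q hq].
by exists q%:R; rewrite -natrM mulnC -hq natr_Zp.
Qed.

(** Point masses satisfy the coset conditions trivially, which covers [c_0 = 1], where [1 - c] is
    not a unit. *)
Lemma haar_of_degenerate (mu1 mu2 : probability (Delta p) R) :
  degenerate_distr mu1 -> degenerate_distr mu2 ->
  exists (K : set (Delta p)) (mK : probability (Delta p) R) (x1 x2 : Delta p),
    compact_subgroup K /\ padic_haar K mK /\
    eq_distr mu1 (pshift mK x1) /\ eq_distr mu2 (pshift mK x2).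
Proof.
have E (mu : probability (Delta p) R) x : eq_distr mu (@dirac _ (Delta p) x R) ->
    forall n (a : 'Z_(p ^ n.+1)),
    law mu a = (phi n x == a)%:R.
  move=> h n a; rewrite /law h; last exact: measurable_cyl.
  rewrite diracE; congr (_%:R); have [e|ne] := eqVneq (phi n x) a.
    by rewrite mem_set.
  by rewrite memNset // /cyl /=; exact/eqP.
move=> [x1 /E h1] [x2 /E h2].
apply: (@haar_of_cosets _ _ hp mu1 mu2 x1 x2) => n a.
  rewrite h1; case: eqP => [<- _ y|_]; first by rewrite subrr addr0.
  by rewrite ltxx.
rewrite h1 h2; congr (nat_of_bool _ )%:R.
by rewrite -[in RHS]subr_eq subrr [in RHS]eq_sym subr_eq0 eq_sym.
Qed.

Lemma degenerate_c1 (mu1 mu2 : probability (Delta p) R) (c : Delta p) :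
  (forall n, sym_law (@law R p mu1 n) (@law R p mu2 n) (phi n c)) ->
  (2 < p)%N -> phi 0 c = 1 -> degenerate_distr mu1 /\ degenerate_distr mu2.
Proof.
move=> hs p2 c1; apply: (@rigid_degenerate _ _ hp _ _ _ hs 1%N).
  by move=> n b b'; rewrite !mul1r => ->.
move=> n; have [|q hq] := @red_eq0 n.+1 0 (1 - phi n.+1 c).
  by rewrite redD // redN // (red_nat hp 1) // red_phi // c1 subrr.
exists (1 + phi n.+1 c), q; split; first by rewrite mul1r.
  by rewrite hq mul1r expn1.
rewrite red_unit // redD // (red_nat hp 1) // red_phi // c1.
rewrite -[1%:R + 1](natrD _ 1 1) natr_eq0Z // expn1.
by apply: contraTN p2 => /dvdn_leq; rewrite -leqNgt; apply.
Qed.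

End PartOne.

Lemma degenerate_two {R : realType} (mu1 mu2 : probability (Delta 2) R) (c : Delta 2) :
  (forall n, sym_law (@law R 2 mu1 n) (@law R 2 mu2 n) (phi n c)) ->
  (c 0%N : nat) = 1%N -> (c 1%N : nat) = 0%N ->
  degenerate_distr mu1 /\ degenerate_distr mu2.
Proof.
have hp : prime 2 by [].
move=> hs c0 c1; apply: (@rigid_degenerate _ _ hp _ _ _ hs 2%N).
  (* Cancelling [2] turns a congruence modulo [2 ^ n.+2] into one modulo [2 ^ n.+1]. *)
  move=> n b b'; rewrite -(natr_Zp b) -(natr_Zp b').
  move: (nat_of_ord b) (nat_of_ord b') => {b b'} b b'; rewrite -!natrM => h.
  rewrite !red_nat //; apply/eq_natrZ => //; move/(@eq_natrZ 2 hp): h => /eqP.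
  by rewrite expnS -!muln_modr eqn_pmul2l // => /eqP.
move=> n; have [|q hq] := @red_eq0 2 hp n.+1 1 (1 - phi n.+1 c).
  rewrite redD // redN // (red_nat hp 1) // red_phi // /phi /trunc.
  by rewrite !big_ord_recr big_ord0 /= c0 c1 subrr.
(* Since [c] is 1 modulo 4, [1 - c = 4 q] and hence [1 + c = 2 (1 - 2 q)]. *)
exists (1 - 2 * q), q; split.
- by rewrite (_ : phi n.+1 c = 1 - (2 ^ 2)%:R * q); [ring|rewrite -hq; ring].
- by rewrite hq -natrM.
rewrite red_unit // redD // redN // redM // (red_nat hp 1) // (red_nat hp 2) //.
Qed.

(** * Measures with a prescribed first digit *)

Section Digits.
Context {R : realType} {p : nat} (hp : prime p).
Implicit Types x : R.

(** The base [p] digits of the real [x], the leading fractional digit becoming the digit of index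
    0. *)
Definition expansion (x : R) : Delta p :=
  fun k => inord (Num.truncn (x * (p ^ k.+1)%:R) %% p).

Let p0 : (0 < p)%N. Proof. exact: prime_gt0. Qed.

Lemma truncn_step x k : 0 <= x ->
  Num.truncn (x * (p ^ k)%:R) = (Num.truncn (x * (p ^ k.+1)%:R) %/ p)%N.
Proof.
move=> x0; have pk0 j : 0 <= x * (p ^ j)%:R by apply: mulr_ge0.
apply: truncn_def; have /andP[h1 h2] := truncn_itv (pk0 k.+1).
set m := Num.truncn (x * (p ^ k.+1)%:R) in h1 h2 *.
have pR : 0 < p%:R :> R by rewrite ltr0n.
rewrite -(ler_pM2r pR) -(ltr_pM2r pR) -mulrA -!natrM -expnSr.
rewrite (le_trans _ h1) ?(lt_le_trans h2) // ler_nat; first exact: ltn_ceil.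
exact: leq_divM.
Qed.

Lemma expansion_cyl n (y : Delta p) : exists m : nat, (m < p ^ n.+1)%N /\
  forall x, 0 <= x < 1 ->
    phi n (expansion x) = phi n y <-> Num.truncn (x * (p ^ n.+1)%:R) = m.
Proof.
have E x k : (expansion x k : nat) = (Num.truncn (x * (p ^ k.+1)%:R) %% p)%N.
  by rewrite /expansion inordK // prednK // ltn_mod.
have trunc_small x k : 0 <= x < 1 -> (Num.truncn (x * (p ^ k)%:R) < p ^ k)%N.
  move=> /andP[x0 x1]; rewrite truncn_lt_nat ?mulr_ge0 // gtr_pMl //.
  by rewrite ltr0n expn_gt0 p0.
elim: n => [|n [m [hm IH]]].
  exists (y 0%N : nat); split; first by rewrite expn1 digit_lt.
  move=> x x01; have hx : (Num.truncn (x * (p ^ 1)%:R) < p)%N.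
    by apply: leq_trans (trunc_small x 1%N x01) _; rewrite expn1.
  split=> [/(phi_ext hp)/(_ 0%N isT)/(congr1 (@nat_of_ord _))|h].
    by rewrite E modn_small.
  apply/(phi_ext hp) => k; rewrite leqn0 => /eqP ->; apply: val_inj => /=.
  by rewrite E modn_small // h.
(* The digit order is reversed: a further digit of [y] is the least significant one of the interval
   index. *)
exists (m * p + y n.+1)%N; split.
  rewrite expnSr; apply: (@leq_trans (m.+1 * p)); last by rewrite leq_mul2r hm orbT.
  by rewrite mulSn addnC ltn_add2r digit_lt.
move=> x x01; have x0 : 0 <= x by case/andP: x01.
have hphi : phi n.+1 (expansion x) = phi n.+1 y <->
    phi n (expansion x) = phi n y /\ expansion x n.+1 = y n.+1.
  split=> [h|[/(phi_ext hp) h1 h2]].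
    split; first exact: (phi_compat hp (leqnSn n) h).
    by move/(phi_ext hp): h; apply.
  apply/(phi_ext hp) => k; rewrite leq_eqVlt => /orP[/eqP -> //|]; exact: h1.
rewrite hphi IH // (truncn_step n.+1 x0); split=> [[<- <-]|h].
  by rewrite E -divn_eq.
split; first by rewrite h divnMDl // divn_small ?addn0 // digit_lt.
by apply: val_inj; rewrite /= E h modnMDl modn_small // digit_lt.
Qed.

Lemma measurable_truncn_eq (q : R) m : 0 < q ->
  measurable [set x : R | Num.truncn (x * q) = m].
Proof.
move=> q0.
have mle k : measurable [set x : R | (Num.truncn (x * q) < k)%N].
  case: k => [|k].
    by rewrite (_ : mkset _ = set0) //; apply/seteqP; split.
  rewrite (_ : mkset _ = `]-oo, (k.+1%:R / q)[%classic); first exact: measurable_itv.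
  by apply/seteqP; split => x /=; rewrite ltnS truncn_le_nat in_itv /= ltr_pdivlMr.
rewrite (_ : mkset _ = [set x : R | (Num.truncn (x * q) < m.+1)%N] `\`
   [set x : R | (Num.truncn (x * q) < m)%N]); first exact: measurableD.
apply/seteqP; split => x /= => [->|[]]; first by rewrite ltnS leqnn ltnn.
by rewrite ltnS => h1 h2; apply/eqP; rewrite eqn_leq h1 leqNgt; apply/negP.
Qed.

Lemma measurable_expansion : measurable_fun setT expansion.
Proof.
apply: (measurable_fun_cyl hp) => n a.
have -> : [set x : R | phi n (expansion x) = a] = \bigcap_(k in `I_n.+1)
    [set x : R | expansion x k = rep a k].
  apply/seteqP; split => x /=.
    by rewrite -{1}(repK hp a) => /(phi_ext hp) h k /= kn; exact: h.
  by move=> h; rewrite -[RHS](repK hp a); apply/(phi_ext hp) => k; exact: h.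
apply: bigcap_measurable => [|k _]; first by exists 0%N.
rewrite (_ : mkset _ = \bigcup_(m in [set m | (inord (m %% p) : digit p) = rep a k])
    [set x : R | Num.truncn (x * (p ^ k.+1)%:R) = m]).
  apply: bigcup_measurable => m _; apply: measurable_truncn_eq.
  by rewrite ltr0n expn_gt0 p0.
apply/seteqP; split => x /=; first by exists (Num.truncn (x * (p ^ k.+1)%:R)).
by move=> [m /= hm mE]; rewrite /expansion mE.
Qed.

(** Lebesgue measure on [[0, 1)] is pushed forward by [expansion]; a cylinder pulls back to an
    interval of length [1 / p ^ n.+1]. *)
Lemma haar_exists : exists mu : probability (Delta p) R,
  forall n (a : 'Z_(p ^ n.+1)), law mu a = (p ^ n.+1)%:R^-1.
Proof.
have mI : measurable (`[0, 1[%classic : set R) by exact: measurable_itv.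
pose m := mrestr (@lebesgue_measure R) mI.
have m1 : m setT = 1%E.
  by rewrite /m /mrestr setTI lebesgue_measure_itv /= lte01 oppr0 adde0.
pose P : probability _ R := HB.pack m (Measure_isProbability.Build _ _ _ m m1).
have [mu muE] := pushforward_probability P measurable_expansion.
exists mu => n a; apply/EFin_inj; rewrite -lawE // muE /= /m /mrestr.
have [k [hk kE]] := expansion_cyl n (rep a).
have q0 : 0 < (p ^ n.+1)%:R :> R by rewrite ltr0n expn_gt0 p0.
rewrite (_ : _ `&` _ = `[k%:R / (p ^ n.+1)%:R, k.+1%:R / (p ^ n.+1)%:R[%classic).
  rewrite lebesgue_measure_itv /= lte_fin ltr_pM2r ?invr_gt0 // ltr_nat ltnSn.
  by rewrite -EFinD -mulrBl -natrB // subSnn mul1r.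
apply/seteqP; split => x; rewrite /cyl /= !in_itv /=.
  move=> [xa x01]; have /andP[x0 _] := x01; rewrite -[a](repK hp) in xa.
  rewrite ler_pdivrMr // ltr_pdivlMr // -truncn_eq ?mulr_ge0 //.
  by rewrite (kE x x01).1.
rewrite ler_pdivrMr // ltr_pdivlMr // => hx.
have /andP[h1 h2] := hx.
have x0 : 0 <= x by rewrite -(pmulr_lge0 _ q0) (le_trans _ h1).
have x01 : 0 <= x < 1.
  by rewrite x0 /= -(ltr_pM2r q0) mul1r (lt_le_trans h2) // ler_nat hk.
split=> //; rewrite -[RHS](repK hp a); apply: (kE x x01).2.
by rewrite (truncn_def hx).
Qed.

Lemma mixture_exists (nu : 'Z_(p ^ 1) -> R) :
  (forall j, 0 <= nu j) -> \sum_j nu j = 1 ->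
  exists mu : probability (Delta p) R,
    forall n (a : 'Z_(p ^ n.+1)), law mu a = nu (red 0 a) / (p ^ n)%:R.
Proof.
move=> nu0 nu1; have [H HE] := haar_exists.
have w0 k : 0 <= p%:R * nu k%:R by apply: mulr_ge0.
(* Haar measure is restricted to each first-digit cylinder, whose mass is [1 / p], and reweighted by
   [p * nu k]. *)
pose m := msum (fun k => mscale (NngNum (w0 k))
  (mrestr H (measurable_cyl hp (k%:R : 'Z_(p ^ 1))))) p.
have mE n (a : 'Z_(p ^ n.+1)) : m (cyl a) = (nu (red 0 a) / (p ^ n)%:R)%:E.
  have -> : m (cyl a) = (\sum_(k < p) (p%:R * nu k%:R)%:E *
      H (cyl a `&` cyl (k%:R : 'Z_(p ^ 1))))%E by [].
  have hj : (red 0 a < p)%N.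
    by apply: leq_trans (ltn_ord (red 0 a)) _; rewrite Zp_cast ?expn_gt1 // expn1.
  rewrite (bigD1 (Ordinal hj)) //= natr_Zp big1 ?adde0 => [|i /= hi].
    rewrite (_ : _ `&` _ = cyl a); last first.
      by apply/setIidPl => x; rewrite /cyl /= => <-; rewrite red_phi.
    rewrite lawE // HE -EFinM; congr EFin.
    have pR : p%:R != 0 :> R by rewrite pnatr_eq0 -lt0n.
    by rewrite expnS natrM invfM; field; rewrite pR pnatr_eq0 -lt0n expn_gt0 p0.
  rewrite (_ : _ `&` _ = set0) ?measure0 ?mule0 //.
  rewrite -subset0 => x [/= xa]; rewrite /cyl /= => xi; case/eqP: hi; apply: val_inj => /=.
  by rewrite -xa red_phi // xi val_Zp_nat ?expn_gt1 // modn_small // expn1.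
have m1 : m setT = 1%E.
  rewrite (_ : setT = [set x : Delta p | xpredT (phi 0 x)]); last by apply/seteqP; split.
  pose mm : {measure set (Delta p) -> \bar R} := m.
  apply: (etrans (@measure_finval _ _ _ (phi 0) (measurable_cyl hp (n := 0)) R mm xpredT)).
  rewrite (eq_bigr (fun a => (nu a)%:E)) ?sumEFin ?nu1 // => a _.
  by have := mE 0%N a; rewrite expn0 divr1 -{2}[a](repK hp) red_phi // repK.
pose P : probability (Delta p) R := HB.pack m (Measure_isProbability.Build _ _ _ m m1).
by exists P => n a; apply/EFin_inj; rewrite -lawE // -mE.
Qed.

End Digits.

(** * Integrals as measures *)

Section IntegralMeasures.
Context {R : realType} {d : measure_display} {T : measurableType d}.
Variable mu : {measure set T -> \bar R}.

(** Packaging integrals as measures, here in the domain and next in the argument of the kernel, lets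
    uniqueness on cylinders act on each variable separately. *)
Lemma integral_measure_set (f : T -> \bar R) :
  measurable_fun [set: T] f -> (forall x, 0 <= f x)%E ->
  exists m : {measure set T -> \bar R}, forall A, m A = (\int[mu]_(x in A) f x)%E.
Proof.
move=> mf f0; pose m (A : set T) := (\int[mu]_(x in A) f x)%E.
have e0 : m set0 = 0%E by rewrite /m integral_set0.
have ge0 A : (0 <= m A)%E by apply: integral_ge0.
have sa : semi_sigma_additive m.
  move=> F mF tF mUF; rewrite /m ge0_integral_bigcup //; last exact: measurable_funTS.
  apply/cvg_closeP; split; last by rewrite closeE.
  by apply: is_cvg_nneseries => n _ _; exact: integral_ge0.
pose M : {measure set T -> \bar R} := HB.pack m (isMeasure.Build _ _ _ m e0 ge0 sa).
by exists M.
Qed.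

Lemma integral_measure_kernel d' (U : measurableType d')
    (k : T -> {measure set U -> \bar R}) (A : set T) : measurable A ->
  (forall B, measurable B -> measurable_fun setT (k ^~ B)) ->
  exists m : {measure set U -> \bar R}, forall B, m B = (\int[mu]_(x in A) k x B)%E.
Proof.
move=> mA mk; pose m (B : set U) := (\int[mu]_(x in A) k x B)%E.
have e0 : m set0 = 0%E by rewrite /m integral0_eq // => x _; rewrite measure0.
have ge0 B : (0 <= m B)%E by apply: integral_ge0.
have sa : semi_sigma_additive m.
  move=> F mF tF mUF.
  rewrite /m [X in _ --> X](_ : _ = (\int[mu]_(x in A) (\sum_(n <oo) k x (F n)))%E).
    rewrite integral_nneseries //; last by move=> n; exact/measurable_funTS/mk.
    apply/cvg_closeP; split; last by rewrite closeE.
    by apply: is_cvg_nneseries => n _ _; exact: integral_ge0.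
  apply: eq_integral => x _; apply/esym/cvg_lim => //.
  exact/measure_semi_sigma_additive.
pose M : {measure set U -> \bar R} := HB.pack m (isMeasure.Build _ _ _ m e0 ge0 sa).
by exists M.
Qed.

End IntegralMeasures.

Lemma pushforward_measure {R : realType} d d' (T : measurableType d)
    (U : measurableType d') (m : {measure set T -> \bar R}) (f : T -> U) :
  measurable_fun setT f ->
  exists m' : {measure set U -> \bar R}, forall A, m' A = m (f @^-1` A).
Proof.
move=> mf.
by unshelve refine (ex_intro _ (pushforward m f : {measure set U -> \bar R}) _).
Qed.

(** * Recognising a conditional distribution on cylinders *)

Section ConditionalLaw.
Context {R : realType} {p : nat} (hp : prime p).
Context {d : measure_display} {Om : measurableType d} {P : probability Om R}.

(** Uniqueness is used twice: first in [A] with [B] a cylinder, then in [B] with [A] arbitrary.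
    Predicates [S] allow a coarse cylinder to be tested at a finer level. *)
Lemma cond_dist_levels n1 (L V : Om -> Delta p) (Q : R.-pker (Delta p) ~> (Delta p)) :
  measurable_fun setT L -> measurable_fun setT V ->
  (forall n (a : 'Z_(p ^ n.+1)) (S : pred 'Z_(p ^ n.+1)), (n1 <= n)%N ->
    P (L @^-1` cyl a `&` [set w | S (phi n (V w))]) =
    (\int[pushforward P L]_(x in cyl a) Q x [set y | S (phi n y)])%E) ->
  cond_dist P L V Q.
Proof.
move=> mL mV h.
have [PL PLE] := pushforward_probability P mL.
have pre (f : Om -> Delta p) A : measurable_fun setT f -> measurable A ->
    measurable (f @^-1` A).
  by move=> mf mA; rewrite -[X in measurable X]setTI; exact: mf.
have iE A f : (\int[pushforward P L]_(x in A) f x = \int[PL]_(x in A) f x)%E.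
  by congr (integral _ _ _); apply/funext => B; rewrite PLE.
have restr (f g : Om -> Delta p) B : measurable_fun setT f -> measurable_fun setT g ->
    measurable B -> exists m : {measure set (Delta p) -> \bar R},
    (m setT < +oo)%E /\ forall A, m A = P (f @^-1` A `&` g @^-1` B).
  move=> mf mg mB; pose r := mrestr P (pre g B mg mB).
  have [m mE] := pushforward_measure r mf; exists m; split=> //; rewrite mE.
  rewrite /= /r /mrestr; apply: (@le_lt_trans _ _ 1%E); last exact: ltry.
  by apply: probability_le1; apply: measurableI; apply pre.
have QE B : measurable B -> measurable_fun setT (fun x => Q x B).
  exact: measurable_kernel.
have step1 n (b : 'Z_(p ^ n.+1)) A : measurable A ->
    P (L @^-1` A `&` V @^-1` cyl b) = (\int[PL]_(x in A) Q x (cyl b))%E.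
  have [m1 [fin m1E]] := restr L V _ mL mV (measurable_cyl hp b).
  have [m2 m2E] := integral_measure_set PL (QE _ (measurable_cyl hp b))
    (fun x => measure_ge0 (Q x) _).
  move=> mA; rewrite -m1E -m2E.
  (* Only levels fine enough both to see [b] and to satisfy [h] are tested. *)
  apply: (@measure_cyl_ext p hp R (maxn n n1)) mA => // N a hN.
  have hn : (n <= N)%N by apply: leq_trans hN; exact: leq_maxl.
  have E : cyl b = [set y | red n (phi N y) == b].
    by apply/seteqP; split => y; rewrite /cyl /= red_phi // => /eqP.
  rewrite m1E m2E -iE [in RHS]E -(h N a (fun z => red n z == b)).
    by congr (P (_ `&` _)); rewrite E.
  by apply: leq_trans hN; exact: leq_maxr.
move=> A B mA mB.
have [m1 [fin m1E]] := restr V L _ mV mL mA.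
have [m2 m2E] := integral_measure_kernel PL mA QE.
rewrite setIC -m1E iE -m2E.
apply: (@measure_cyl_ext p hp R 0) mB => // n b _.
by rewrite m1E m2E setIC step1.
Qed.

End ConditionalLaw.

(** * The counterexample *)

Section Reflection.
Context {A : comUnitRingType} (c f : A).
Hypothesis cE : c = -1 + 2 * f.
Hypothesis uf : 1 - f \is a GRing.unit.

(** The solution of [x' + y' = x + y], [x' + c y' = - (x + c y)] with the common factor 2 cancelled,
    so that [2] need not be invertible. *)
Definition reflection (z : A * A) : A * A :=
  (((1 - 2 * f) * z.2 - f * z.1) / (1 - f), (z.1 + f * z.2) / (1 - f)).

Let fV : (1 - f) / (1 - f) = 1. Proof. exact: divrr. Qed.

Lemma reflectionK : involutive reflection.
Proof.
have h x u : u * (1 - f) = 1 -> (u * (1 - f)) ^+ 2 * x = x :> A.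
  by move=> ->; rewrite expr1n mul1r.
move=> [x y]; rewrite /reflection /=; have := fV; rewrite mulrC; move: (1 - f)^-1 => u hu.
by congr (_, _); [rewrite -[RHS](h x u)|rewrite -[RHS](h y u)] => //; ring.
Qed.

Lemma reflection_sum z : (reflection z).1 + (reflection z).2 = z.1 + z.2.
Proof.
rewrite /reflection /=; have := fV; rewrite mulrC; move: (1 - f)^-1 => u hu.
transitivity (u * (1 - f) * (z.1 + z.2)); first by ring.
by rewrite hu mul1r.
Qed.

Lemma reflection_diff z :
  (reflection z).1 + c * (reflection z).2 = - (z.1 + c * z.2).
Proof.
rewrite /reflection cE /=; have := fV; rewrite mulrC; move: (1 - f)^-1 => u hu.
transitivity (u * (1 - f) * - (z.1 + (-1 + 2 * f) * z.2)); first by ring.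
by rewrite hu mul1r.
Qed.

End Reflection.

Lemma kernel_exists {R : realType} d d' (X : measurableType d) (Y : measurableType d')
    (k : X -> probability Y R) :
  (forall B, measurable B -> measurable_fun [set: X] (fun x => k x B)) ->
  exists Q : R.-pker X ~> Y, forall x B, Q x B = k x B.
Proof.
move=> mk; pose K : X -> {measure set Y -> \bar R} := fun x => k x.
pose K1 : R.-ker X ~> Y := HB.pack K (isKernel.Build _ _ X Y R K mk).
have pK x : K1 x setT = 1%E by exact: probability_setT.
pose Q : R.-pker X ~> Y := HB.pack K (isKernel.Build _ _ X Y R K mk)
  (Kernel_isProbability.Build _ _ X Y R K1 pK).
by exists Q.
Qed.

Section Counterexample.
Context {R : realType} {p : nat} (hp : prime p).
Local Notation Z1 := 'Z_(p ^ 1).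

Lemma measurable_finite_choice d (T : measurableType d) (I : finType)
    (X : T -> I) (g : I -> T -> \bar R) :
  (forall i, measurable [set w | X w = i]) ->
  (forall i, measurable_fun [set: T] (g i)) ->
  measurable_fun [set: T] (fun w => g (X w) w).
Proof.
move=> mX mg _ Y mY; rewrite setTI.
rewrite (_ : _ @^-1` Y = \bigcup_(i in [set: I]) ([set w | X w = i] `&` (setT `&` g i @^-1` Y))).
  by apply: fin_bigcup_measurable => // i _; apply: measurableI => //; exact: mg.
apply/seteqP; split => w /=; first by exists (X w).
by case=> i _ /= [-> [_]].
Qed.

(** [kap j] plays the conditional law of [xi1] given the first digit [j] of [L1]; when [L1 = s] and
    [xi1 = x], [L2] equals [x + c (s - x)]. *)
Lemma fibre_kernel (kap : Z1 -> probability (Delta p) R) (c : Delta p) :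
  exists Q : R.-pker (Delta p) ~> (Delta p), forall s B,
    Q s B = kap (phi 0 s) [set x | B (padd x (pmul c (padd s (popp x))))].
Proof.
have m1 : measurable_fun setT (fun z : Delta p * Delta p => z.1) by exact: measurable_fst.
have m2 : measurable_fun setT (fun z : Delta p * Delta p => z.2) by exact: measurable_snd.
have mG : measurable_fun setT (fun z : Delta p * Delta p =>
    padd z.2 (pmul c (padd z.1 (popp z.2)))).
  by apply: measurable_padd => //; apply: measurable_pmul => //;
     apply: measurable_padd => //; exact: measurable_popp.
have mid : measurable_fun setT (id : Delta p -> Delta p) by exact: measurable_id.
have mGs s : measurable_fun setT (fun x : Delta p => padd x (pmul c (padd s (popp x)))).
  by apply: measurable_padd => //; apply: measurable_pmul => //;
     apply: measurable_padd => //; exact: measurable_popp.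
pose k s := sval (cid (pushforward_probability (kap (phi 0 s)) (mGs s))).
have kE s B : k s B = kap (phi 0 s) [set x | B (padd x (pmul c (padd s (popp x))))].
  by rewrite /k; case: cid.
have [|Q QE] := @kernel_exists R _ _ _ _ k; last by exists Q => s B; rewrite QE kE.
(* For fixed [j] the map is the measure of a section; the finitely many values of [j] are then
   glued. *)
move=> B mB; pose g (j : Z1) (s : Delta p) := kap j (xsection ((fun z : Delta p * Delta p =>
  padd z.2 (pmul c (padd z.1 (popp z.2)))) @^-1` B) s).
rewrite (_ : (fun x => k x B) = fun s => g (phi 0 s) s).
  apply: (@measurable_finite_choice _ (Delta p) Z1 (phi 0) g).
    by move=> i; exact: (measurable_cyl hp i).
  have mB' : measurable ((fun z : Delta p * Delta p =>
      padd z.2 (pmul c (padd z.1 (popp z.2)))) @^-1` B).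
    by rewrite -[X in measurable X]setTI; exact: mG.
  by move=> j; exact: (measurable_fun_xsection (kap j) mB').
apply/funext => s; rewrite kE; congr (kap _ _).
by apply/seteqP; split => x; rewrite /xsection /= inE.
Qed.

Lemma sum_antidiagonal n (a : 'Z_(p ^ n.+1)) (S : pred ('Z_(p ^ n.+1) * 'Z_(p ^ n.+1)))
    (F : 'Z_(p ^ n.+1) * 'Z_(p ^ n.+1) -> R) :
  \sum_(z | (z.1 + z.2 == a) && S z) F z = \sum_(y | S (y, a - y)) F (y, a - y).
Proof.
rewrite (reindex_onto (fun y => (y, a - y)) fst) /=.
  by apply: eq_bigl => y; rewrite addrC subrK !eqxx andbT.
by move=> [x y] /= /andP[/eqP <- _]; rewrite addrC addKr.
Qed.

Section FirstDigit.
Variable nu : Z1 -> R.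
Hypothesis nu_gt0 : forall j, 0 < nu j.
Variable mu : probability (Delta p) R.
Hypothesis muE : forall n (a : 'Z_(p ^ n.+1)), law mu a = nu (red 0 a) / (p ^ n)%:R.

(** Given the sum, the first digit has weight [nu i * nu (j - i)] and the other digits stay uniform;
    [N] normalises, and [T] is the mass of the sum at [a]. *)
Lemma fibre_law_exists (j : Z1) : exists kap : probability (Delta p) R,
  forall n (a : 'Z_(p ^ n.+1)), red 0 a = j -> exists T : R, forall y,
    law mu y * law mu (a - y) = T * law kap y.
Proof.
pose N := \sum_i nu i * nu (j - i).
have N0 : 0 < N.
  rewrite /N (bigD1 0) //=; apply: ltr_pwDl; first exact: mulr_gt0.
  by apply: sumr_ge0 => i _; rewrite ltW // mulr_gt0.
have [|| kap kapE] := @mixture_exists R p hp (fun i => nu i * nu (j - i) / N).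
- by move=> i; rewrite ltW // divr_gt0 // mulr_gt0.
- by rewrite -mulr_suml divff // gt_eqF.
exists kap => n a aj; exists (N / (p ^ n)%:R) => y.
rewrite !muE kapE redD // redN // aj.
have pn0 : (p ^ n)%:R != 0 :> R by rewrite pnatr_eq0 -lt0n expn_gt0 prime_gt0.
by field; rewrite pn0 gt_eqF.
Qed.

(** Full support of the first digit puts an element with first digit 1 into [K]; invariance under it
    would force [nu 0 = nu 1]. *)
Lemma not_in_I (xi : set (Delta p) -> \bar R) :
  nu 0 != nu 1 -> (forall A, measurable A -> xi A = mu A) -> ~ in_I xi.
Proof.
move=> ne xiE [K [mK [x [[cK _] [[K1 hK] hx]]]]].
have mKm : measurable K.
  have oK : open (~` (K : set (DeltaT p))).
    apply: closed_openC; apply: compact_closed cK.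
    apply: (@hausdorff_product nat (fun=> discrete_topology (digit p))) => _.
    exact: discrete_hausdorff.
  by rewrite -(setCK K); apply: measurableC; apply: sub_gen_smallest.
have lawx (a : Z1) : nu a = law mK (a - phi 0 x).
  have <- : law mu a = nu a by rewrite muE expn0 divr1 -{1}[a](repK hp) red_phi // repK.
  rewrite /law -xiE ?hx; [|exact: measurable_cyl..].
  congr (fine (mK _)); apply/seteqP; split => y; rewrite /cyl /= phiD //.
    by move=> <-; rewrite addrK.
  by move=> ->; rewrite subrK.
(* Otherwise [mK] would not charge the cylinder of first digit 1, whose mass is
   [nu (1 + phi 0 x)]. *)
have [k Kk k1] : exists2 k, K k & phi 0 k = 1.
  apply: contrapT => hN.
  have : (mK K <= mK (~` cyl (1%R : Z1)))%E.
    apply: le_measure; rewrite ?inE //.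
      by apply: measurableC; exact: measurable_cyl.
    by move=> y Ky y1; apply: hN; exists y.
  rewrite K1 probability_setC ?lawE //; last exact: measurable_cyl.
  rewrite -EFinB lee_fin lerBrDr -subr_ge0 opprD addrA subrr sub0r oppr_ge0.
  have := nu_gt0 (1 + phi 0 x); rewrite lawx addrK => h1 h2.
  by have := lt_le_trans h1 h2; rewrite ltxx.
case/eqP: ne; rewrite !lawx /law -[in RHS](hK k Kk) ?sub0r; last exact: measurable_cyl.
congr (fine (mK _)); apply/seteqP; split => y; rewrite /cyl /= phiD // k1.
  by move=> ->.
by move=> /addrI.
Qed.

Section Independent.
Variable c : Delta p.
Context {d : measure_display} {Om : measurableType d} {P : probability Om R}.
Context {xi1 xi2 : Om -> Delta p}.
Hypothesis m1 : measurable_fun setT xi1.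
Hypothesis m2 : measurable_fun setT xi2.
Hypothesis law1 : forall A, measurable A -> mu A = P (xi1 @^-1` A).
Hypothesis law2 : forall A, measurable A -> mu A = P (xi2 @^-1` A).
Hypothesis ind : indep_rv P xi1 xi2.

Let L1 w := padd (xi1 w) (xi2 w).
Let L2 w := padd (xi1 w) (pmul c (xi2 w)).

Lemma joint_sum n (a : 'Z_(p ^ n.+1)) (S : pred 'Z_(p ^ n.+1)) :
  P (L1 @^-1` cyl a `&` [set w | S (phi n (L2 w))]) =
  (\sum_(z : 'Z_(p ^ n.+1) * 'Z_(p ^ n.+1) |
     (z.1 + z.2 == a) && S (z.1 + phi n c * z.2)) law mu z.1 * law mu z.2)%:E.
Proof.
rewrite -(joint_law hp m1 m2 law1 law2 ind
  (fun x y => (x + y == a) && S (x + phi n c * y))).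
congr (P _); apply/seteqP; split => w; rewrite /cyl /L1 /L2 /= !phiD // phiM //.
  by case=> -> ->; rewrite eqxx.
by move=> /andP[/eqP -> ->].
Qed.

Lemma fibre_cond_dist n1 (kap : Z1 -> probability (Delta p) R)
    (Q : R.-pker (Delta p) ~> (Delta p)) (V : Om -> Delta p) :
  (forall n (a : 'Z_(p ^ n.+1)), exists T : R, forall y,
    law mu y * law mu (a - y) = T * law (kap (red 0 a)) y) ->
  (forall s B, Q s B =
    kap (phi 0 s) [set x | B (padd x (pmul c (padd s (popp x))))]) ->
  measurable_fun setT V ->
  (forall n (a : 'Z_(p ^ n.+1)) (S : pred 'Z_(p ^ n.+1)), (n1 <= n)%N ->
    P (L1 @^-1` cyl a `&` [set w | S (phi n (V w))]) =
    P (L1 @^-1` cyl a `&` [set w | S (phi n (L2 w))])) ->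
  cond_dist P L1 V Q.
Proof.
move=> hT QE mV hV.
have mL1 : measurable_fun setT L1 by exact: measurable_padd.
apply: (@cond_dist_levels _ _ hp _ _ _ n1) => // n a S hn; rewrite hV //.
have [T TE] := hT n a.
have sumE (S' : pred ('Z_(p ^ n.+1) * 'Z_(p ^ n.+1))) :
    \sum_(z | (z.1 + z.2 == a) && S' z) law mu z.1 * law mu z.2 =
    T * \sum_(y | S' (y, a - y)) law (kap (red 0 a)) y.
  by rewrite sum_antidiagonal mulr_sumr; apply: eq_bigr => y _; rewrite TE.
(* On [cyl a] the integrand depends only on the residue of [x], hence is constant. *)
rewrite (@eq_integral _ _ _ _ _ (cst
    (\sum_(y | S (y + phi n c * (a - y))) law (kap (red 0 a)) y)%:E)); last first.
  move=> x; rewrite inE => xa; rewrite QE -(red_phi hp x (leq0n n)) xa.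
  rewrite -(law_pred hp _ (fun y => S (y + phi n c * (a - y)))).
  congr (kap _ _); apply/seteqP; split => y;
    by rewrite /= phiD // phiM // phiD // phiN // xa.
rewrite integral_cst; last exact: measurable_cyl.
rewrite joint_sum (sumE (fun z => S (z.1 + phi n c * z.2))) /=.
rewrite /pushforward (_ : L1 @^-1` cyl a =
    L1 @^-1` cyl a `&` [set w | xpredT (phi n (L2 w))]); last first.
  by apply/seteqP; split => w //; case.
by rewrite (joint_sum a xpredT) (sumE xpredT) law_sum1 // mulr1 -EFinM mulrC.
Qed.

Lemma swap_symmetric : (forall n, (0 < n)%N -> exists2 f : 'Z_(p ^ n.+1),
    phi n c = -1 + 2 * f & red 0 f = 0) ->
  cond_symmetric P L1 L2.
Proof.
move=> hf; have mL2 : measurable_fun setT L2.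
  by apply: measurable_padd => //; exact: measurable_pmul.
pose kap j := sval (cid (fibre_law_exists j)).
have kapE n (a : 'Z_(p ^ n.+1)) : exists T : R, forall y,
    law mu y * law mu (a - y) = T * law (kap (red 0 a)) y.
  by rewrite /kap; case: cid => k /= /(_ n a); exact.
have [Q QE] := fibre_kernel kap c; exists Q; split.
  exact: (@fibre_cond_dist 0 kap).
(* The comparison starts at level 1, the first at which [hf] provides [f]. *)
apply: (@fibre_cond_dist 1 kap) => // [|n a S n0]; first exact: measurable_popp.
have [f cE f0] := hf n n0.
have uf : 1 - f \is a GRing.unit.
  by rewrite red_unit // redD // redN // f0 subr0 (red_nat hp 1).
have rV : red 0 ((1 - f)^-1) = 1.
  have := congr1 (red 0) (divrr uf); rewrite redM // redD // redN // f0 subr0.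
  by rewrite (red_nat hp 1) // mul1r.
rewrite joint_sum (_ : [set w | S (phi n (popp (L2 w)))] =
    [set w | (fun v => S (- v)) (phi n (L2 w))]); last first.
  by apply/seteqP; split => w; rewrite /= phiN.
rewrite (joint_sum a (fun v => S (- v))); congr EFin.
(* Joint masses depend only on first digits, which the reflection swaps because [f] vanishes
   there. *)
rewrite (reindex_inj (inv_inj (reflectionK uf))); apply: eq_big => z.
  by rewrite reflection_sum // (reflection_diff cE) // opprK.
have r1 : red 0 (1 : 'Z_(p ^ n.+1)) = 1 by rewrite (red_nat hp 1).
have e1 : red 0 (reflection f z).1 = red 0 z.2.
  rewrite /reflection /= redM // rV mulr1 redD // redN // !redM // redD // redN // redM //.
  by rewrite f0 r1 mulr0 mul0r !subr0 mul1r.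
have e2 : red 0 (reflection f z).2 = red 0 z.1.
  by rewrite /reflection /= redM // rV mulr1 redD // redM // f0 mul0r addr0.
by move=> _; rewrite !muE e1 e2 mulrC.
Qed.

End Independent.

End FirstDigit.

Lemma half_exists (c : Delta p) :
  ((2 < p)%N /\ (c 0%N : nat) = p.-1) \/
    (p = 2%N /\ (c 0%N : nat) = 1%N /\ (c 1%N : nat) = 1%N) ->
  forall n, (0 < n)%N -> exists2 f : 'Z_(p ^ n.+1),
    phi n c = -1 + 2 * f & red 0 f = 0.
Proof.
have r1 k n : (k <= n)%N -> red k (1 : 'Z_(p ^ n.+1)) = 1 by move=> h; rewrite (red_nat hp 1).
move=> [[p2 c0]|[p2 [c0 c1]]] n n0.
  have u2 k : (2 : 'Z_(p ^ k.+1)) \is a GRing.unit.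
    rewrite red_unit // red_nat // natr_eq0Z // expn1.
    by apply: contraTN p2 => /dvdn_leq; rewrite -leqNgt; apply.
  exists ((1 + phi n c) / 2); first by rewrite mulrC (divrK (u2 n)) addKr.
  have h : 2 * red 0 ((1 + phi n c) / 2) = 0.
    rewrite -(red_nat hp 2 (leq0n n)) -redM // mulrC (divrK (u2 n)) redD // r1 // red_phi //.
    rewrite phi0E c0 -[1]/(1%:R) -natrD add1n prednK ?prime_gt0 //.
    by apply/eqP; rewrite natr_eq0Z // expn1.
  by apply: (mulrI (u2 0%N)); rewrite h mulr0.
have [|q hq] := @red_eq0 p hp n 1 (1 + phi n c).
  rewrite redD // r1 // red_phi // /phi /trunc !big_ord_recr big_ord0 /= c0 c1.
  rewrite -[1]/(1%:R) -natrD; apply/eqP; rewrite natr_eq0Z //.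
  by rewrite [in X in (_ %| X)%N]p2 p2.
(* Here [1 + c = 4 q], so [f = 2 q] vanishes modulo 2; level 0 could not see the digit [c_1]. *)
exists (2 * q).
  rewrite mulrA -natrM -(addKr 1 (phi n c)) hq.
  by congr (_ + _%:R * _); rewrite p2.
rewrite redM // red_nat // (_ : 2%:R = 0) ?mul0r //.
by apply/eqP; rewrite natr_eq0Z // p2.
Qed.

Lemma counterexample (c : Delta p) :
  ((2 < p)%N /\ (c 0%N : nat) = p.-1) \/
    (p = 2%N /\ (c 0%N : nat) = 1%N /\ (c 1%N : nat) = 1%N) ->
  exists (d : measure_display) (Om : measurableType d) (P : probability Om R)
         (xi1 xi2 : Om -> Delta p),
     measurable_fun [set: Om] xi1 /\ measurable_fun [set: Om] xi2 /\
     indep_rv P xi1 xi2 /\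
     cond_symmetric P (fun w => padd (xi1 w) (xi2 w))
                      (fun w => padd (xi1 w) (pmul c (xi2 w))) /\
     ~ in_I (distr_of P xi1) /\ ~ in_I (distr_of P xi2).
Proof.
move=> /half_exists hf.
(* Weight 2 at residue 0 and 1 at the [p - 1] others: positive, not uniform, of total [p + 1]. *)
pose nu (j : Z1) : R := ((j == 0).+1)%:R / p.+1%:R.
have nu0 j : 0 < nu j by rewrite divr_gt0 // ltr0n.
have nuN : nu 0 != nu 1.
  rewrite /nu eqxx (negbTE (oner_neq0 _)) eqr_div ?pnatr_eq0 //.
  by rewrite (inj_eq (mulIf _)) ?pnatr_eq0 // eqr_nat.
have cardZ1 : #|{: Z1}| = p by rewrite card_ord Zp_cast ?expn_gt1 // expn1.
have nu1 : \sum_j nu j = 1.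
  rewrite -mulr_suml -natr_sum (eq_bigr (fun j : Z1 => (j == 0%R) + 1)%N); last first.
    by move=> j _; rewrite addn1.
  rewrite big_split /= sum1_card cardZ1 (bigD1 (0 : Z1)) //= big1 => [|j /negbTE -> //].
  by rewrite addn0 add1n divff // pnatr_eq0.
have [mu muE] := mixture_exists hp (fun j => ltW (nu0 j)) nu1.
pose m := (mu \x mu)%E.
have mT : m setT = 1%E.
  have -> : [set: Delta p * Delta p] = setT `*` setT by apply/seteqP; split.
  rewrite /m product_measure1E //.
  exact: (etrans (f_equal2 mule (probability_setT mu) (probability_setT mu)) (mule1 _)).
pose P : probability (Delta p * Delta p)%type R :=
  HB.pack m (Measure_isProbability.Build _ _ _ m mT).
have f1 : measurable_fun setT (fst : Delta p * Delta p -> Delta p) by exact: measurable_fst.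
have f2 : measurable_fun setT (snd : Delta p * Delta p -> Delta p) by exact: measurable_snd.
have PE A B : measurable A -> measurable B -> P (fst @^-1` A `&` snd @^-1` B) = (mu A * mu B)%E.
  by move=> mA mB; exact: product_measure1E.
have l1 A : measurable A -> mu A = P (fst @^-1` A).
  by move=> mA; rewrite -[X in P X]setIT -(preimage_setT snd) PE // probability_setT mule1.
have l2 A : measurable A -> mu A = P (snd @^-1` A).
  by move=> mA; rewrite -[X in P X]setTI -(preimage_setT fst) PE // probability_setT mul1e.
have ind : indep_rv P fst snd by move=> A B mA mB; rewrite PE // l1 // l2.
exists _, (Delta p * Delta p)%type, P, fst, snd; do 3?split=> //.
split; first exact: (swap_symmetric nu0 muE).
by split; apply: (not_in_I nu0 muE nuN) => A mA; rewrite /distr_of /pushforward -?l1 -?l2.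
Qed.

End Counterexample.

(** * Rigidity and counterexample combined, by cases on the first digits of [c] *)

Theorem theorem2 (R : realType) (p : nat) (hp : prime p) (c : Delta p)
    (hc : invertible c) :
  (* Part 1 *)
  (forall (d : measure_display) (Om : measurableType d) (P : probability Om R)
          (xi1 xi2 : Om -> Delta p),
      measurable_fun [set: Om] xi1 -> measurable_fun [set: Om] xi2 ->
      indep_rv P xi1 xi2 ->
      cond_symmetric P (fun w => padd (xi1 w) (xi2 w))
                       (fun w => padd (xi1 w) (pmul c (xi2 w))) ->
      (* (i) *)
      ((2 < p)%N -> (c 0%N : nat) != p.-1 ->
         (exists (K : set (Delta p)) (mK : probability (Delta p) R)
                 (x1 x2 : Delta p),
            compact_subgroup K /\ padic_haar K mK /\
            eq_distr (distr_of P xi1) (pshift mK x1) /\ eq_distr (distr_of P xi2) (pshift mK x2)) /\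
         ((c 0%N : nat) = 1%N -> degenerate_distr (distr_of P xi1) /\ degenerate_distr (distr_of P xi2))) /\
      (* (ii) *)
      (p = 2%N -> (c 0%N : nat) = 1%N -> (c 1%N : nat) = 0%N ->
         degenerate_distr (distr_of P xi1) /\ degenerate_distr (distr_of P xi2))) /\
  (* Part 2 *)
  (((2 < p)%N /\ (c 0%N : nat) = p.-1) \/
   (p = 2%N /\ (c 0%N : nat) = 1%N /\ (c 1%N : nat) = 1%N) ->
   exists (d : measure_display) (Om : measurableType d) (P : probability Om R)
          (xi1 xi2 : Om -> Delta p),
     measurable_fun [set: Om] xi1 /\ measurable_fun [set: Om] xi2 /\
     indep_rv P xi1 xi2 /\
     cond_symmetric P (fun w => padd (xi1 w) (xi2 w))
                      (fun w => padd (xi1 w) (pmul c (xi2 w))) /\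
     ~ in_I (distr_of P xi1) /\ ~ in_I (distr_of P xi2)).
Proof.
split; last by move=> h; exact: counterexample.
move=> d Om P xi1 xi2 m1 m2 ind sym.
have [mu1 mu1E] := pushforward_probability P m1.
have [mu2 mu2E] := pushforward_probability P m2.
have hs n := cond_symmetric_law hp m1 m2 (fun A _ => mu1E A) (fun A _ => mu2E A)
  ind (n := n) sym.
have <- : (mu1 : set (Delta p) -> \bar R) = distr_of P xi1.
  by apply/funext => A; rewrite mu1E.
have <- : (mu2 : set (Delta p) -> \bar R) = distr_of P xi2.
  by apply/funext => A; rewrite mu2E.
split=> [p2 cN1|p2 c0 c1]; last by move: (p2) => pE; subst p; exact: degenerate_two hs c0 c1.
have deg : (c 0%N : nat) = 1%N -> degenerate_distr mu1 /\ degenerate_distr mu2.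
  by move=> c0; apply: (degenerate_c1 hp hs p2); rewrite phi0E c0.
(* For [c_0 = 1] the Haar form comes from degeneracy; otherwise all four units are available. *)
split=> //; have [c1|c1] := eqVneq (c 0%N : nat) 1%N.
  by have [d1 d2] := deg c1; exact: haar_of_degenerate.
have cp : (c 0%N < p)%N by exact: digit_lt.
apply: (rigid_units hp hs p2); rewrite phi0E.
- by rewrite natr_eq0Z // expn1 gtnNdvd // lt0n.
- apply: contra c1 => /eqP /(@eq_natrZ p hp 0 _ 1) /eqP.
  by rewrite expn1 !modn_small // prime_gt1.
rewrite -subr_eq0 opprK -[1]/(1%:R) -natrD natr_eq0Z // expn1 addn1.
apply: contra cN1 => /dvdn_leq; move=> /(_ isT) h.
apply/eqP; have := prime_gt0 hp; lia.
Qed.
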